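(* Let $n>k\ge 1$ be relatively prime integers and let $i,j\in\mathbb{Z}_n$. Write $[x_a,x_b]:=x_a\otimes x_b-x_b\otimes x_a\in V\otimes V$. (1) If $i\neq j$, then $L_{ij}(0)=\mathbb{C}\cdot[x_i,x_j]$. (2) If $r_{ii}(\tau)$ is not identically zero on $E-E[n]$ (i.e. as a function of $\tau\in\mathbb{C}-\frac1n\Lambda$), then $$L_{ii}(0)=\mathbb{C}\cdot\sum_{r=1}^{\lceil n/2\rceil-1}\frac{\theta_{(k-1)r}(0)}{\theta_{-r}(0)\,\theta_{kr}(0)}\,[x_{i-r},x_{i+r}].$$ (3) $Q_{n,k}(E,0)=\mathbb{C}[x_0,\ldots,x_{n-1}]$, the polynomial ring on $n$ variables.
   Context: Notation: $e(z)=e^{2\pi i z}$; $\mathbb{Z}_n=\mathbb{Z}/n\mathbb{Z}$. Fix $\eta\in\mathbb{C}$ in the upper half-plane, $\Lambda=\mathbb{Z}+\mathbb{Z}\eta$, $E=\mathbb{C}/\Lambda$, and $E[n]=\frac1n\Lambda/\Lambda$. Let $\theta(z)=\sum_{m\in\mathbb{Z}}(-1)^m e\big(mz+\tfrac12 m(m-1)\eta\big)$ and, for $\alpha\in\mathbb{Z}$, $$\theta_\alpha(z)=e\Big(\alpha z+\tfrac{\alpha}{2n}+\tfrac{\alpha(\alpha-n)}{2n}\eta\Big)\prod_{m=0}^{n-1}\theta\Big(z+\tfrac mn+\tfrac{\alpha}{n}\eta\Big),$$ which depends only on $\alpha$ modulo $n$; the zeros of the $\theta_\alpha$'s lie in $\frac1n\Lambda$.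 Let $V$ be a $\mathbb{C}$-vector space with basis $\{x_i\mid i\in\mathbb{Z}_n\}$ and $TV=\mathbb{C}\langle x_0,\ldots,x_{n-1}\rangle$ its tensor algebra. For $\tau\in\mathbb{C}-\frac1n\Lambda$ and $i,j\in\mathbb{Z}_n$ let $$r_{ij}(\tau)=\sum_{r\in\mathbb{Z}_n}\frac{\theta_{j-i+(k-1)r}(0)}{\theta_{j-i-r}(-\tau)\,\theta_{kr}(\tau)}\;x_{j-r}\otimes x_{i+r}\in V\otimes V.$$ Up to a non-zero scalar, $r_{ij}(\tau)$ depends only on $\tau+\Lambda$. If $r_{ij}$ is not identically zero on $\mathbb{C}-\frac1n\Lambda$, then it is nowhere zero there, and $\tau\mapsto L_{ij}(\tau):=\mathbb{C}\cdot r_{ij}(\tau)$ is a morphism $E-E[n]\to\mathbb{P}(V\otimes V)$ (the projective space of $1$-dimensional subspaces) that extends uniquely to a morphism $L_{ij}:E\to\mathbb{P}(V\otimes V)$; for $\tau\in\mathbb{C}$, $L_{ij}(\tau)\subseteq V\otimes V$ denotes the line that is the image of $\tau+\Lambda$. For all $\tau\in\mathbb{C}$ (or $\tau\in E$), $\mathrm{rel}_{n,k}(E,\tau)\subseteq V\otimes V$ is the linear span of these $L_{ij}(\tau)$'s (over all $(i,j)$ with $r_{ij}$ not identically zero), and $Q_{n,k}(E,\tau)=TV/(\mathrm{rel}_{n,k}(E,\tau))$. Equality of algebras presented on the generators $x_i$ means equality as quotients of $TV$. *)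

(* Defs.v *)
From HB Require Import structures.
From mathcomp Require Import all_boot all_order all_algebra.
From mathcomp Require Import all_classical all_reals all_analysis.
From mathcomp Require Import complex.
(* The notations of [monalg] and [mpoly] clash with those of the analysis
   library. *)
From mathcomp.multinomials Require Import -(notations) monalg.
From mathcomp.multinomials Require Import -(notations) mpoly.

Set Implicit Arguments.
Unset Strict Implicit.
Unset Printing Implicit Defensive.

Import Order.TTheory GRing.Theory Num.Theory.
Import numFieldNormedType.Exports.

Local Open Scope classical_set_scope.
Local Open Scope ring_scope.

Section Theta.
Context {R : realType}.
Local Notation C := R[i].

Definition expC (z : C) : C :=
  (expR (complex.Re z))%:C%C
  * (cos (complex.Im z) +i* sin (complex.Im z))%C.

Definition ezp (z : C) : C := expC (2 * (pi : R)%:C%C * 'i%C * z).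

Variable eta : C.

Definition Lambda : set C :=
  [set z | exists a b : int, z = a%:~R + b%:~R * eta].

(* (1/n) Lambda *)
Definition torsion (n : nat) : set C := [set z | Lambda (n%:R * z)].

Definition theta_term (z : C) (m : int) : C :=
  (-1) ^ m * ezp (m%:~R * z + (m * (m - 1))%:~R / 2 * eta).

(* The sum over all integers converges absolutely, so it is the limit of its
   symmetric partial sums, over - N <= m <= N. *)
Definition theta (z : C) : C :=
  lim ((fun N : nat =>
    (\sum_(0 <= l < N.*2.+1) theta_term z (l%:Z - N%:Z) : C^o)) @ \oo).

Definition theta_ (n : nat) (a : int) (z : C) : C :=
  ezp (a%:~R * z + a%:~R / (2 * n%:R)
     + (a * (a - n%:Z))%:~R / (2 * n%:R) * eta)
  * \prod_(0 <= m < n) theta (z + m%:R / n%:R + a%:~R / n%:R * eta).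

(* theta_ n a only depends on a modulo n *)
Definition thetaZ (n : nat) (a : 'Z_n) (z : C) : C := theta_ n (a : nat)%:Z z.

(* A morphism from the elliptic curve C / Lambda to the projective space of
   lines of 'M[C]_d, as a Lambda-periodic function on C: a map which near every
   point is the line spanned by a nowhere vanishing holomorphic vector. *)
Definition proj_morphism (d : nat) (L : C -> {vspace 'M[C]_d}) : Prop :=
  (forall z l : C, Lambda l -> L (z + l) = L z) /\
  (forall z0 : C, exists g : C -> 'M[C]_d,
    \forall z \near (z0 : C^o),
      [/\ forall a b, derivable (fun w : C^o => g w a b : C^o) z 1,
          g z != 0 & L z = <[g z]>%VS]).

End Theta.

Section TensorAlgebra.
Context {R : realType} {n : nat}.
Local Notation C := R[i].
(* 'I_d is 'Z_n, which has n elements only for 1 < n. *)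
Local Notation d := (Zp_trunc n).+2.

Definition xgen (a : 'Z_n) : 'rV[C]_d := delta_mx 0 a.

(* V (x) V is identified with 'M[C]_d, the entry (a, b) being the coefficient
   on xgen a (x) xgen b. *)
Definition tens (u v : 'rV[C]_d) : 'M[C]_d := u^T *m v.

Definition bracket (a b : 'Z_n) : 'M[C]_d :=
  tens (xgen a) (xgen b) - tens (xgen b) (xgen a).

Definition TV : lalgType C := malg (fmonom 'Z_n) C.

Definition xgenT (a : 'Z_n) : TV := mkmalgU (fmu a) (1 : C).

Definition tens2_TV (M : 'M[C]_d) : TV :=
  \sum_(a : 'Z_n) \sum_(b : 'Z_n) M a b *: (xgenT a * xgenT b).

Definition poly_ring : algType C := mpoly d C.

(* The algebra morphism TV -> C[x_0, ..., x_(n-1)] sending x_a to x_a. *)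
Definition TV_to_poly (t : TV) : poly_ring :=
  monalg.mmap (mpolyC d (R := C) : C -> poly_ring)
       (fun m : fmonom 'Z_n => \prod_(a <- fmonom_val m) mpolyX C (mnm1 a)) t.

End TensorAlgebra.

Definition two_sided_ideal (A : pzRingType) (I : set A) : Prop :=
  [/\ I 0, forall s t, I s -> I t -> I (s - t)
    & forall a s, I s -> I (a * s) /\ I (s * a)].

Definition ideal_gen (A : pzRingType) (S : set A) : set A :=
  smallest (@two_sided_ideal A) S.

(* p exhibits B as the quotient algebra A / I: a surjective algebra morphism
   with kernel I.  So B and A / I are equal as quotients of A. *)
Definition is_quotient_map (K : pzRingType) (A B : lalgType K) (I : set A)
    (p : A -> B) : Prop :=
  [/\ linear p, monoid_morphism p, forall b, exists a, p a = b
    & forall a, p a = 0 <-> I a].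

Section Relations.
Context {R : realType}.
Local Notation C := R[i].
Variables (n k : nat) (eta : C).
Local Notation d := (Zp_trunc n).+2.

Definition rvec (i j : 'Z_n) (tau : C) : 'M[C]_d :=
  \sum_(r : 'Z_n)
    (thetaZ eta (j - i + (k%:R - 1) * r) 0
     / (thetaZ eta (j - i - r) (- tau) * thetaZ eta (k%:R * r) tau))
    *: tens (xgen (j - r)) (xgen (i + r)).

Definition rvec_identically_zero (i j : 'Z_n) : Prop :=
  forall tau : C, ~ torsion eta n tau -> rvec i j tau = 0.

Definition extends_rvec (i j : 'Z_n) (L : C -> {vspace 'M[C]_d}) : Prop :=
  proj_morphism eta L /\
  forall tau : C, ~ torsion eta n tau -> L tau = <[rvec i j tau]>%VS.

(* The unique morphism extending the line of rvec i j.  There is none when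
   rvec i j is identically zero, and then the value is the zero space. *)
Definition Lline (i j : 'Z_n) : C -> {vspace 'M[C]_d} :=
  xget (fun=> 0%VS) [set L | extends_rvec i j L].

Definition rel_nk (tau : C) : {vspace 'M[C]_d} :=
  (\sum_(i : 'Z_n) \sum_(j : 'Z_n | `[< ~ rvec_identically_zero i j >])
     Lline i j tau)%VS.

(* Q_{n,k}(E, tau) is the quotient of TV by this ideal. *)
Definition Q_ideal (tau : C) : set (@TV R n) :=
  ideal_gen (tens2_TV @` [set M | M \in rel_nk tau]).

End Relations.

(* Main.v *)
Require Import Defs.
From HB Require Import structures.
From mathcomp Require Import all_boot all_order all_algebra.
From mathcomp Require Import all_classical all_reals all_analysis.
From mathcomp Require Import complex ring lra zify.
From mathcomp.multinomials Require monalg mpoly.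

(** Write x = e(z), q = e(eta) and beta = j - i.  The coefficient of
    x_(j - r) (x) x_(i + r) in r_ij(tau) is
      theta_(beta + (k - 1) r)(0)
        / (theta_(beta - r)(- tau) theta_(k r)(tau)),
    and these tensors are linearly independent, so everything depends on
    where the functions theta_a vanish.

    Zeros of theta.  Pairing the terms of index - l and l + 1 of the series
    gives theta = A(1/x) - x A(x) with A entire [thetaE], whence the value
    theta(0) = 0 and the behaviour under z + 1, z + eta and - z.  That theta
    has no zero outside Lambda comes from the triple product: the q-binomial
    theorem gives a finite version of it [finite_triple_product], whose
    quotient by a central Gaussian binomial converges to theta; the finite
    products stay away from 0 as soon as none of their factors vanishes
    [theta_x_neq0].  Hence theta_a vanishes only at points (A + B eta) / n with
    a = - B modulo n [thetaZ_zero].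

    Extension of the lines.  As theta_(- a)(- z) is a nowhere zero multiple of
    theta_a(z), the two denominators are theta_(r - beta)(tau) and
    theta_(k r)(tau) up to units.  Near (A + B eta) / n put a = - B: only
    r = a + beta and r = a / k give a pole.  If these two indices agree, the
    numerator at that index is theta_0(0) = 0 and r_ij itself is
    holomorphic and nonzero [regular_off_pole].  Otherwise theta_a r_ij extends
    holomorphically and is nonzero, since the numerator at r = a + beta is not
    0 [polar_frame].  The local frames glue to a morphism on E
    [extension_exists], which is unique because torsion points are isolated
    and 2 x 2 minors are continuous [line_continuation].

    Values at 0.  Here a = 0.  If i <> j, the two poles are at r = 0 and
    r = beta; the coefficients of theta_0 r_ij at 0 are 1 and - 1 there and
    0 elsewhere [Lline_off_diagonal].  If i = j, the line is
    spanned by r_ii(0), whose coefficients are odd in r [diag_coefN], so that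
    the terms r and n - r make up a commutator [Lline_diagonal].

    The algebra.  By these two computations the relations at 0 span the space
    of all commutators.  A word is congruent to its sorted rearrangement
    modulo the commutators, so the linear map sending a monomial to its
    sorted word inverts the map from the quotient to the polynomial ring
    [polynomial_quotient]. *)

Set Implicit Arguments.
Unset Strict Implicit.
Unset Printing Implicit Defensive.
Import Order.TTheory GRing.Theory Num.Theory.
Import numFieldNormedType.Exports.
Local Open Scope classical_set_scope.
Local Open Scope ring_scope.

(** * Limits and series of complex numbers *)

Section ComplexLimits.
Context {R : realType}.
Local Notation C := R[i].

Lemma ger0_complex (x : C) : 0 <= x -> x = (complex.Re x)%:C%C.
Proof. by move=> x0; rewrite RRe_real// ger0_real. Qed.

Lemma ge0_Re (x : C) : 0 <= x -> 0 <= complex.Re x.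
Proof. by move=> x0; rewrite -ler0c -ger0_complex. Qed.

Lemma gt0_Re (x : C) : 0 < x -> 0 < complex.Re x.
Proof. by move=> x0; rewrite -ltcR -ger0_complex// ltW. Qed.

Lemma norm_real_complex (x : R) : `|x%:C%C| = `|x|%:C%C :> C.
Proof. by rewrite normc_def /= expr0n addr0 sqrtr_sqr. Qed.

Lemma normc_ge_Im (z : C) : `|complex.Im z|%:C%C <= `|z|.
Proof.
have := normc_ge_Re (z * 'i%C); rewrite ReiNIm normrN normrM.
by rewrite [`|'i%C|]normc_def /= expr0n expr1n add0r sqrtr1 mulr1.
Qed.

Lemma norm_complex_le (z : C) : `|z| <= (`|complex.Re z| + `|complex.Im z|)%:C%C.
Proof.
rewrite {1}[z]complexE (le_trans (ler_normD _ _))// rmorphD /= normrM.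
rewrite [`|'i%C|]normc_def /= expr0n expr1n add0r sqrtr1 mul1r.
by rewrite !norm_real_complex.
Qed.

Lemma cvg_real_complex {T} (F : set_system T) {FF : Filter F} (u : T -> R) (l : R) :
  u @ F --> l -> ((u x)%:C%C : C^o) @[x --> F] --> (l%:C%C : C^o).
Proof.
move=> /cvgrPdist_lt ul; apply/cvgrPdist_lt => e e0.
have := ul _ (gt0_Re e0); apply: filterS => x.
by rewrite -rmorphB /= norm_real_complex -ltcR -ger0_complex// ltW.
Qed.

Lemma half_lt1 : `|2^-1 : R| < 1.
Proof. by rewrite ger0_norm ?invr_ge0// invf_lt1// ltr1n. Qed.

(** Meaningful for series dominated by a geometric one, which is the case of
    every series met below. *)
Definition series_sum (t : nat -> C) : C := lim ((\sum_(l < N) t l : C^o) @[N --> \oo]).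

Lemma geometric_sum_le (t : nat -> C) (K : C) N : 0 <= K ->
  (forall l, (l < N)%N -> `|t l| <= K * 2^-1 ^+ l) ->
  `|\sum_(l < N) t l| <= 2 * K.
Proof.
move=> K0 tK.
suff : `|\sum_(l < N) t l| <= 2 * K * (1 - 2^-1 ^+ N).
  move=> /le_trans; apply; apply: ler_piMr; first by rewrite mulr_ge0.
  by rewrite lerBlDr lerDl exprn_ge0// invr_ge0.
elim: N tK => [|N IH] tK; first by rewrite big_ord0 normr0 subrr mulr0.
have {}IH := IH (fun l lN => tK l (ltnW lN)).
rewrite big_ord_recr /= (le_trans (ler_normD _ _))// (le_trans (lerD IH (tK N _)))//.
rewrite exprS le_eqVlt; apply/orP; left; apply/eqP.
by field.
Qed.

(** The real and imaginary parts are dominated by the same real geometric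
    series. *)
Lemma series_sum_cvg (t : nat -> C) (K : C) :
  (forall l, `|t l| <= K * 2^-1 ^+ l) ->
  (\sum_(l < N) t l : C^o) @[N --> \oo] --> (series_sum t : C^o).
Proof.
move=> tK.
have K0 : 0 <= K by have := le_trans (normr_ge0 _) (tK 0%N); rewrite expr0 mulr1.
have aux (u : nat -> R) : (forall l, `|u l| <= complex.Re K * 2^-1 ^+ l) ->
  cvgn (fun N => \sum_(l < N) u l).
  move=> uK.
  rewrite (_ : (fun N => _) = series u); last first.
    by apply/funext => N; rewrite /series /= big_mkord.
  apply: (@normed_cvg R R u).
  apply: (@series_le_cvg _ _ (geometric (complex.Re K) 2^-1)) => //.
  - by move=> n; apply: normr_ge0.
  - by move=> n; rewrite /geometric /= mulr_ge0 ?exprn_ge0 ?invr_ge0// ge0_Re.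
  - exact/is_cvg_geometric_series/half_lt1.
have real_half l : K * 2^-1 ^+ l = (complex.Re K * 2^-1 ^+ l)%:C%C.
  by rewrite rmorphM rmorphXn /= fmorphV rmorph_nat -ger0_complex.
have /cvg_ex[a ua] : cvgn (fun N => \sum_(l < N) complex.Re (t l)).
  apply: (aux (fun l => complex.Re (t l))) => l /=; rewrite -lecR -real_half.
  exact: le_trans (normc_ge_Re _) (tK l).
have /cvg_ex[b ub] : cvgn (fun N => \sum_(l < N) complex.Im (t l)).
  apply: (aux (fun l => complex.Im (t l))) => l /=; rewrite -lecR -real_half.
  exact: le_trans (normc_ge_Im _) (tK l).
apply/cvg_ex; exists (a%:C%C + 'i%C * b%:C%C).
have -> : (fun N => \sum_(l < N) t l) =
    (fun N => (\sum_(l < N) complex.Re (t l))%:C%C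
              + 'i%C * (\sum_(l < N) complex.Im (t l))%:C%C).
  apply/funext => N; rewrite !rmorph_sum mulr_sumr -big_split /=.
  by apply: eq_bigr => l _; rewrite -complexE.
exact: (cvgD (cvg_real_complex ua)
             (cvgMl_tmp (a := ('i%C : C^o)) (cvg_real_complex ub))).
Qed.

Lemma cvg_norm_le (u : nat -> C) (l B : C) :
  (u n : C^o) @[n --> \oo] --> (l : C^o) -> (forall n, `|u n| <= B) -> `|l| <= B.
Proof.
move=> /cvgrPdist_le ul uB; apply/ler_addgt0Pr => e e0.
have [N _ /(_ N (leqnn N))/=] := ul e e0 => h.
by rewrite -[l](subrK (u N)) (le_trans (ler_normD _ _))// addrC lerD.
Qed.

End ComplexLimits.

(** * Holomorphic functions *)

Section Holomorphy.
Context {R : realType}.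
Local Notation C := R[i].

(** With C^o, the complex plane as a module over itself, on both sides,
    derivability in the direction 1 is complex differentiability. *)
Definition holo (f : C -> C) (z : C) := derivable (fun w : C^o => f w : C^o) z 1.

Lemma holo_littleo (f : C -> C) (z D : C) :
  (forall e : C, 0 < e -> exists2 d : C, 0 < d &
     forall h, `|h| < d -> `|f (h + z) - f z - h * D| <= e * `|h|) -> holo f z.
Proof.
move=> H; apply/cvg_ex; exists D; apply/cvgrPdist_le => e e0 /=.
have [d d0 dH] := H e e0.
apply: filterS2 (@dnbhs0_lt _ (C^o) _ d0) (@nbhs_dnbhs_neq (C^o) 0) => h hd h0.
rewrite -(ler_pM2r (_ : 0 < `|h|)) ?normr_gt0//.
apply: le_trans (dH h hd); rewrite -normrM distrC.
rewrite le_eqVlt; apply/orP; left; apply/eqP; congr (`|_|).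
rewrite /GRing.scale /= mulr1.
by field.
Qed.

(** The form in which term by term estimates of a power series deliver
    differentiability. *)
Lemma holo_quadratic (f : C -> C) (z D K : C) : 0 <= K ->
  (forall h, `|h| <= 1 -> `|f (h + z) - f z - h * D| <= K * `|h| ^+ 2) -> holo f z.
Proof.
move=> K0 H; apply: (@holo_littleo _ _ D) => e e0.
have s0 : 0 < K + e + 1 by rewrite ltr_wpDr// ltr_wpDl.
exists (e / (K + e + 1)); first by rewrite divr_gt0.
move=> h /ltW hd; have h1 : `|h| <= 1.
  rewrite (le_trans hd)// ler_pdivrMr// mul1r addrAC lerDr.
  by rewrite addr_ge0.
apply: le_trans (H h h1) _; rewrite expr2 mulrA ler_wpM2r//.
apply: le_trans (ler_wpM2l K0 hd) _.
rewrite mulrA ler_pdivrMr// mulrC; apply: ler_wpM2l; first exact: ltW.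
by rewrite -addrA lerDl addr_ge0// ltW.
Qed.

Lemma holoD f g z : holo f z -> holo g z -> holo (fun w => f w + g w) z.
Proof. exact: derivableD. Qed.

Lemma holoM f g z : holo f z -> holo g z -> holo (fun w => f w * g w) z.
Proof. exact: derivableM. Qed.

Lemma holoV f z : f z != 0 -> holo f z -> holo (fun w => (f w)^-1) z.
Proof. exact: derivableV. Qed.

Lemma holo_cst c z : holo (fun=> c) z.
Proof. exact: derivable_cst. Qed.

Lemma holo_id z : holo id z.
Proof. exact: derivable_id. Qed.

Lemma holo_comp f g z : holo f z -> holo g (f z) -> holo (fun w => g (f w)) z.
Proof.
rewrite /holo => /derivable1_diffP df /derivable1_diffP dg.
apply/derivable1_diffP.
exact (differentiable_comp df dg).
Qed.

Lemma holo_continuous f z : holo f z -> {for z, continuous (f : C^o -> C^o)}.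
Proof. by move=> /derivable1_diffP/differentiable_continuous. Qed.

Lemma holo_prod (I : Type) (s : seq I) (f : I -> C -> C) z :
  (forall i, holo (f i) z) -> holo (fun w => \prod_(i <- s) f i w) z.
Proof.
move=> fh; elim: s => [|i s IH].
  by under [X in holo X]eq_fun do rewrite big_nil; apply: holo_cst.
under [X in holo X]eq_fun do rewrite big_cons.
exact (@holoM (f i) (fun w => \prod_(j <- s) f j w) z (fh i) IH).
Qed.

End Holomorphy.

(** * Entire power series and the exponential *)

Section PowerSeries.
Context {R : realType}.
Local Notation C := R[i].

(** These are the coefficients of entire power series.  Bounds replace
    summability because the bound for 2 r yields geometric convergence at the
    radius r. *)
Definition rapid_decay (a : nat -> C) : Prop :=
  forall r : C, 0 <= r -> exists2 K : C, 0 <= K & forall l, `|a l| * r ^+ l <= K.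

Definition power_series (a : nat -> C) (x : C) : C := series_sum (fun l => a l * x ^+ l).

Lemma rapid_decay_terms (a : nat -> C) (r : C) : rapid_decay a -> 0 <= r ->
  exists2 K : C, 0 <= K &
    forall x l, `|x| <= r -> `|a l * x ^+ l| <= K * 2^-1 ^+ l.
Proof.
move=> ad r0; have [|K K0 aK] := ad (2 * r); first by rewrite mulr_ge0.
exists K => // x l xr; rewrite exprVn ler_pdivlMr ?exprn_gt0//.
apply: le_trans (aK l); rewrite normrM normrX exprMn -mulrA ler_wpM2l//.
by rewrite mulrC ler_wpM2l ?exprn_ge0// lerXn2r// nnegrE.
Qed.

Lemma power_series_cvg (a : nat -> C) (x : C) : rapid_decay a ->
  (\sum_(l < N) a l * x ^+ l : C^o) @[N --> \oo] --> (power_series a x : C^o).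
Proof.
move=> ad; have [K K0 aK] := rapid_decay_terms ad (normr_ge0 x).
apply: (@series_sum_cvg _ _ K) => l; exact: aK.
Qed.

(** The generous constant (4 r)^l makes the induction on l immediate; rapid
    decay absorbs it. *)
Lemma power_remainder (x h r : C) l : 1 <= r -> `|x| <= r -> `|h + x| <= r ->
  `|(h + x) ^+ l - x ^+ l - h * (l%:R * x ^+ l.-1)| <= `|h| ^+ 2 * (4 * r) ^+ l.
Proof.
move=> r1 xr hxr; have r0 : 0 <= r by apply: le_trans r1.
elim: l => [|l IH].
  by rewrite !expr0 mul0r mulr0 subr0 subrr normr0 mulr1 exprn_ge0.
have -> : (h + x) ^+ l.+1 - x ^+ l.+1 - h * (l.+1%:R * x ^+ l.+1.-1) =
   (h + x) * ((h + x) ^+ l - x ^+ l - h * (l%:R * x ^+ l.-1))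
   + h ^+ 2 * (l%:R * x ^+ l.-1).
  case: l {IH} => [|l] /=; first by rewrite !expr0 !expr1; ring.
  by rewrite !exprS -[l.+2%:R]natr1 -[l.+1%:R]natr1; ring.
apply: le_trans (ler_normD _ _) _; rewrite [`|h ^+ 2 * _|]normrM normrX.
have e1 : `|(h + x) * ((h + x) ^+ l - x ^+ l - h * (l%:R * x ^+ l.-1))| <=
   `|h| ^+ 2 * (r * (4 * r) ^+ l).
  by rewrite normrM [_ ^+ 2 * (r * _)]mulrCA ler_pM.
have e2 : `|l%:R * x ^+ l.-1| <= 3 * r * (4 * r) ^+ l.
  rewrite normrM normr_nat normrX exprMn.
  have le4 : l%:R <= 3 * 4 ^+ l :> C.
    rewrite -natrX -natrM ler_nat (leq_trans (ltnW (ltn_expl l (isT : 1 < 4)%N)))//.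
    by rewrite leq_pmull.
  rewrite mulrACA ler_pM ?exprn_ge0//.
  apply: le_trans (_ : r ^+ l.-1 <= _); first by rewrite lerXn2r// nnegrE.
  by rewrite -exprS ler_weXn2l// (leq_trans (leq_pred _)).
apply: le_trans (lerD e1 (ler_wpM2l (exprn_ge0 2 (normr_ge0 h)) e2)) _.
rewrite -mulrDr ler_wpM2l ?exprn_ge0// exprS le_eqVlt; apply/orP; left.
by apply/eqP; ring.
Qed.

(** The second order remainders of the monomials add up to O(|h|^2). *)
Lemma power_series_holo (a : nat -> C) (z : C) : rapid_decay a ->
  holo (power_series a) z.
Proof.
(* z and h + z have norm at most r when |h| <= 1 *)
move=> ad; pose r := `|z| + 1; have r1 : 1 <= r by rewrite lerDr.
have r0 : 0 <= r by apply: le_trans r1.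
have [|K K0 aK] := ad (8 * r); first by rewrite mulr_ge0.
have aK' l : `|a l| * (4 * r) ^+ l <= K * 2^-1 ^+ l.
  rewrite exprVn ler_pdivlMr ?exprn_gt0//.
  apply: le_trans (aK l); rewrite -mulrA ler_wpM2l// -exprMn.
  by rewrite le_eqVlt; apply/orP; left; apply/eqP; congr (_ ^+ _); ring.
pose D := series_sum (fun l => a l * (l%:R * z ^+ l.-1)).
have Dcvg : (\sum_(l < N) a l * (l%:R * z ^+ l.-1) : C^o) @[N --> \oo] --> (D : C^o).
  apply: (@series_sum_cvg _ _ K) => l; apply: le_trans (aK' l).
  rewrite normrM ler_wpM2l// normrM normr_nat normrX exprMn ler_pM ?exprn_ge0//.
    by rewrite -natrX ler_nat (ltnW (ltn_expl _ _)).
  apply: le_trans (_ : r ^+ l.-1 <= _).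
    by rewrite lerXn2r// ?nnegrE// lerDl.
  by rewrite ler_weXn2l// leq_pred.
apply: (@holo_quadratic _ _ z D (2 * K)); first by rewrite mulr_ge0.
move=> h h1.
apply: (cvg_norm_le (cvgB (cvgB (@power_series_cvg a (h + z) ad)
   (@power_series_cvg a z ad)) (cvgMl_tmp (a := (h : C^o)) Dcvg))) => N.
change (`|\sum_(l < N) a l * (h + z) ^+ l - \sum_(l < N) a l * z ^+ l
  - h * \sum_(l < N) a l * (l%:R * z ^+ l.-1)| <= 2 * K * `|h| ^+ 2).
rewrite mulr_sumr -!sumrB -mulrA.
rewrite (eq_bigr (fun l : 'I_N => a l *
  ((h + z) ^+ l - z ^+ l - h * (l%:R * z ^+ l.-1)))); last first.
  by move=> l _; ring.
apply: (@geometric_sum_le _ (fun l => a l *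
  ((h + z) ^+ l - z ^+ l - h * (l%:R * z ^+ l.-1)))) => [|l _].
  by rewrite mulr_ge0// exprn_ge0.
rewrite normrM.
have e := @power_remainder z h r l r1 _ _.
apply: le_trans (ler_wpM2l (normr_ge0 _) (e _ _)) _.
- by rewrite lerDl.
- by rewrite (le_trans (ler_normD _ _))// addrC lerD2l.
by rewrite [K * _ * _]mulrAC mulrCA mulrC ler_wpM2r// exprn_ge0.
Qed.

End PowerSeries.

Section Exponential.
Context {R : realType}.
Local Notation C := R[i].

Lemma real_littleo (f : R -> R) (D : R) : is_derive (0 : R) 1 f D ->
  forall e : R, 0 < e -> exists2 d : R, 0 < d &
    forall h, `|h| < d -> `|f h - f 0 - h * D| <= e * `|h|.
Proof.
move=> fD e e0.
have [/cvg_ex[D' fD'] fDD] := fD.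
have DD' : D' = D by rewrite -fDD; apply/esym/cvg_lim.
move: fD'; rewrite DD' => /cvgrPdist_le /(_ e e0) H.
have [d /= d0 dH] := H.
exists d => // h hd.
have [->|h0] := eqVneq h 0; first by rewrite mul0r subr0 subrr normr0 mulr0.
have := dH h; rewrite /ball_ /= sub0r normrN => /(_ hd h0).
rewrite -(ler_pM2r (_ : 0 < `|h|)) ?normr_gt0// => /(le_trans _); apply.
rewrite -normrM distrC le_eqVlt; apply/orP; left; apply/eqP; congr (`|_|).
rewrite /GRing.scale /= addr0 mulr1.
by field.
Qed.

Lemma expCD (z w : C) : expC (z + w) = expC z * expC w.
Proof.
rewrite /expC !raddfD /= expRD cosD sinD rmorphM /=.
by apply/eqP; rewrite eq_complex /=; apply/andP; split; apply/eqP; ring.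
Qed.

Lemma expC0 : expC 0 = 1 :> C.
Proof. by rewrite /expC /= expR0 cos0 sin0 mul1r. Qed.

Lemma expC_neq0 (z : C) : expC z != 0.
Proof.
have : expC z * expC (- z) != 0 by rewrite -expCD subrr expC0 oner_neq0.
by rewrite mulf_eq0 negb_or => /andP[].
Qed.

Lemma expCN (z : C) : expC (- z) = (expC z)^-1.
Proof.
apply: (mulIf (expC_neq0 z)).
by rewrite -expCD addNr expC0 mulVf// expC_neq0.
Qed.

Lemma norm_expC (z : C) : `|expC z| = (expR (complex.Re z))%:C%C.
Proof.
rewrite normrM norm_real_complex [X in X%:C%C * _]ger0_norm ?expR_ge0//.
by rewrite [`|(cos _ +i* _)%C|]normc_def /= cos2Dsin2 sqrtr1 mulr1.
Qed.

(** First order expansions of exp, cos and sin at 0, multiplied out. *)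
Lemma expC_littleo (e : C) : 0 < e ->  exists2 d : C, 0 < d &
  forall h, `|h| < d -> `|expC h - 1 - h| <= e * `|h|.
Proof.
(* the error terms below add up to at most 9 e1 |h| *)
move=> e0; pose e1 := Num.min 1 (complex.Re e / 9).
have e10 : 0 < e1 by rewrite lt_min ltr01 divr_gt0// gt0_Re.
have e11 : e1 <= 1 by rewrite ge_min lexx.
have e12 : 9 * e1 <= complex.Re e.
  have : e1 <= complex.Re e / 9 by rewrite ge_min lexx orbT.
  lra.
clearbody e1.
have [d1 d10 H1] := real_littleo (is_derive_expR 0) e10.
have [d2 d20 H2] := real_littleo (is_derive_cos 0) e10.
have [d3 d30 H3] := real_littleo (is_derive_sin 0) e10.
exists (Num.min e1 (Num.min d1 (Num.min d2 d3)))%:C%C.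
  by rewrite ltcR !lt_min e10 d10 d20 d30.
move=> [a b] hd.
have /andP[ha hb] : (`|a| <= complex.Re `|(a +i* b)%C|) && (`|b| <= complex.Re `|(a +i* b)%C|).
  by rewrite -!lecR -ger0_complex// (normc_ge_Re (a +i* b)%C) (normc_ge_Im (a +i* b)%C).
set n := complex.Re _ in ha hb.
have nE : `|(a +i* b)%C| = n%:C%C by rewrite [LHS]ger0_complex.
move: hd; rewrite nE ltcR !lt_min => /and4P[n1 n2 n3 n4].
have {H1} := H1 a (le_lt_trans ha n2).
have {H2} := H2 b (le_lt_trans hb n3).
have {H3} := H3 b (le_lt_trans hb n4).
rewrite expR0 cos0 sin0 !mulr1 oppr0 mulr0 !addr0 ?subr0.
set w := sin b - b; set v := cos b - 1; set u := expR a - 1 - a => hw hv hu.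
apply: le_trans (norm_complex_le _) _.
rewrite (ger0_complex (ltW e0)) -rmorphM [X in _ <= X]/= lecR.
have -> : complex.Re (expC (a +i* b)%C - 1 - (a +i* b)%C) = u + v + (a + u) * v.
  by rewrite /expC /= /u /v; ring.
have -> : complex.Im (expC (a +i* b)%C - 1 - (a +i* b)%C) = w + (a + u) * (b + w).
  by rewrite /expC /= /u /w; ring.
have n0 : 0 <= n by apply: le_trans ha.
have au : `|a + u| <= 2 * n.
  apply: le_trans (ler_normD _ _) _; nra.
have bw : `|b + w| <= 2 * n.
  apply: le_trans (ler_normD _ _) _; nra.
have vn : `|v| <= e1 * n by nra.
have un : `|u| <= e1 * n by nra.
have wn : `|w| <= e1 * n by nra.
apply: (@le_trans _ _ (9 * e1 * n)); last by nra.
have h1 : `|u + v + (a + u) * v| <= 4 * e1 * n.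
  apply: le_trans (ler_normD _ _) _; rewrite normrM.
  have := ler_normD u v.
  have : `|a + u| * `|v| <= 2 * n * (e1 * n) by rewrite ler_pM.
  nra.
have h2 : `|w + (a + u) * (b + w)| <= 5 * e1 * n.
  apply: le_trans (ler_normD _ _) _; rewrite normrM.
  have : `|a + u| * `|b + w| <= 2 * n * (2 * n) by rewrite ler_pM.
  nra.
by lra.
Qed.

Lemma holo_expC (z : C) : holo (@expC R) z.
Proof.
apply: (@holo_littleo _ _ _ (expC z)) => e e0.
have [|d d0 H] := @expC_littleo (e / `|expC z|).
  by rewrite divr_gt0// normr_gt0 expC_neq0.
exists d => // h hd.
have -> : expC (h + z) - expC z - h * expC z = (expC h - 1 - h) * expC z.
  by rewrite expCD; ring.
rewrite normrM; apply: le_trans (ler_wpM2r (normr_ge0 _) (H h hd)) _.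
by rewrite mulrAC divfK// normr_eq0 expC_neq0.
Qed.

End Exponential.

(** * Gaussian binomials and the finite triple product *)

Lemma bin2_double n : ('C(n.+1, 2) * 2 = n.+1 * n)%N.
Proof. by elim: n => // n IH; rewrite binS bin1 mulnDl IH; lia. Qed.

Section GaussBinomial.
Variables (F : fieldType) (q : F).

(** The q-Pochhammer symbol (q; q)_N. *)
Definition qfact (N : nat) : F := \prod_(m < N) (1 - q ^+ m.+1).

(** Gaussian binomial coefficients, by the q-Pascal rule. *)
Fixpoint qbin (M j : nat) : F :=
  match M, j with
  | M'.+1, j'.+1 => qbin M' j' + q ^+ j'.+1 * qbin M' j'.+1
  | _, 0 => 1
  | 0, _.+1 => 0
  end.

Lemma qbin0 M : qbin M 0 = 1. Proof. by case: M. Qed.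

Lemma qbinS M j : qbin M.+1 j.+1 = qbin M j + q ^+ j.+1 * qbin M j.+1.
Proof. by []. Qed.

Lemma qbin_small M j : (M < j)%N -> qbin M j = 0.
Proof.
elim: M j => [|M IH] [|j] //= Mj.
by rewrite !IH// ?mulr0 ?addr0// ltnW.
Qed.

Arguments qbin : simpl never.

Lemma qfactS N : qfact N.+1 = qfact N * (1 - q ^+ N.+1).
Proof. by rewrite /qfact big_ord_recr. Qed.

Lemma qbin_qfact j i : qbin (j + i) j * (qfact j * qfact i) = qfact (j + i).
Proof.
elim: j i => [|j IHj] i; first by rewrite qbin0 /qfact big_ord0 !mul1r.
elim: i => [|i IHi].
  rewrite addn0 qbinS (@qbin_small j j.+1)// mulr0 addr0 qfactS.
  have := IHj 0%N; rewrite addn0 => IH.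
  by rewrite -[in RHS]IH; ring.
rewrite addnS qbinS.
have e1 := IHj i.+1; rewrite addnS -addSn in e1.
rewrite [in RHS]qfactS mulrDl.
have -> : qbin (j.+1 + i) j * (qfact j.+1 * qfact i.+1) =
  (1 - q ^+ j.+1) * qfact (j.+1 + i) by rewrite -e1 (qfactS j); ring.
have -> : q ^+ j.+1 * qbin (j.+1 + i) j.+1 * (qfact j.+1 * qfact i.+1) =
  q ^+ j.+1 * (1 - q ^+ i.+1) * qfact (j.+1 + i).
  by rewrite -IHi (qfactS i); ring.
by rewrite -addnS exprD; ring.
Qed.

(** The q-binomial theorem: splitting off the factor 1 - y replaces y by q y in
    the others, and the q-Pascal rule merges the two resulting sums. *)
Lemma gauss_binomial (M : nat) (y : F) :
  \prod_(m < M) (1 - y * q ^+ m) =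
  \sum_(j < M.+1) (-1) ^+ j * q ^+ 'C(j, 2) * qbin M j * y ^+ j.
Proof.
elim: M y => [|M IH] y.
  by rewrite big_ord0 big_ord_recl big_ord0 /= !expr0 !mulr1 addr0.
rewrite big_ord_recl expr0 mulr1.
rewrite (eq_bigr (fun m : 'I_M => 1 - y * q * q ^+ m)); last first.
  by move=> m _; rewrite lift0 exprS mulrA.
rewrite IH mulrBl mul1r [LHS]addrC.
rewrite [X in _ + X = _]big_ord_recl [in RHS]big_ord_recl /= qbin0 !expr0 !mulr1 addrCA; congr (_ + _).
rewrite mulr_sumr -sumrN.
rewrite (eq_bigr (fun l : 'I_M.+1 => (-1) ^+ l.+1 * q ^+ ('C(l, 2) + l) * qbin M l * y ^+ l.+1)); last first.
  by move=> l _; rewrite !exprS exprD exprMn; ring.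
have -> : \sum_(l < M) (-1) ^+ bump 0 l * q ^+ 'C(bump 0 l, 2) * qbin M (bump 0 l) * (y * q) ^+ bump 0 l =
  \sum_(l < M.+1) (-1) ^+ l.+1 * q ^+ ('C(l, 2) + l) * (q ^+ l.+1 * qbin M l.+1) * y ^+ l.+1.
  rewrite big_ord_recr /= (@qbin_small M M.+1)// !mulr0 mul0r addr0.
  by apply: eq_bigr => l _; rewrite /bump leq0n add1n binS bin1 exprMn; ring.
rewrite -big_split /=; apply: eq_bigr => l _.
rewrite /bump leq0n add1n binS bin1 qbinS; ring.
Qed.

Hypothesis qfact_neq0 : forall N, qfact N != 0.

Lemma qbin_sym i j : qbin (i + j) j = qbin (i + j) i.
Proof.
apply: (mulIf (qfact_neq0 i)); apply: (mulIf (qfact_neq0 j)).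
rewrite -!mulrA qbin_qfact [qfact i * _]mulrC addnC qbin_qfact.
by rewrite addnC.
Qed.

Hypothesis q_neq0 : q != 0.

(** The q-binomial theorem for 2 N + 1 factors at y = x q^(- N).  The first N
    factors contain a negative power of q, and pulling - x q^(- m) out of them
    turns them into factors in 1 / x; in the sum, the terms of index N - l and
    N + 1 + l carry the same Gaussian binomial. *)
Lemma finite_triple_product (N : nat) (x : F) : x != 0 ->
  (1 - x) * (\prod_(m < N) (1 - x * q ^+ m.+1) * \prod_(m < N) (1 - x^-1 * q ^+ m.+1))
  = \sum_(l < N.+1) (-1) ^+ l * q ^+ 'C(l.+1, 2) * (x^-1 ^+ l - x ^+ l.+1)
      * qbin (N + N.+1) (N - l).
Proof.
move=> x0.
have qE m : q ^+ m != 0 by rewrite expf_neq0.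
(* what is pulled out of the first N factors *)
pose kap := (- x) ^+ N * q^-1 ^+ 'C(N.+1, 2).
have kap0 : kap != 0 by rewrite mulf_neq0 ?expf_neq0 ?oppr_eq0 ?invr_neq0.
apply: (mulfI kap0).
have := gauss_binomial (N + N.+1) (x * q^-1 ^+ N).
rewrite big_split_ord /= => H.
transitivity (\prod_(i < N) (1 - x * q^-1 ^+ N * q ^+ i) *
      \prod_(i < N.+1) (1 - x * q^-1 ^+ N * q ^+ (N + i))).
  rewrite [in RHS]big_ord_recl /= addn0 -mulrA -exprMn mulVf// expr1n mulr1.
  have -> : \prod_(i < N) (1 - x * q^-1 ^+ N * q ^+ (N + bump 0 i)) =
      \prod_(i < N) (1 - x * q ^+ i.+1).
    apply: eq_bigr => i _; rewrite /bump leq0n add1n exprD mulrA -[x * _ * _]mulrA.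
    by rewrite -exprMn mulVf// expr1n mulr1.
  rewrite mulrCA [RHS]mulrCA; congr (_ * _); rewrite mulrCA [RHS]mulrC.
  congr (_ * _); rewrite [RHS](reindex_inj rev_ord_inj) /=.
  have -> : kap = \prod_(m < N) (- x * q^-1 ^+ m.+1).
    rewrite /kap; elim: (N) => [|M IH]; first by rewrite big_ord0 mulr1.
    by rewrite big_ord_recr /= -IH binS bin1 !exprS exprD exprS; ring.
  rewrite -big_split; apply: eq_bigr => m _ /=.
  have mN : (m.+1 <= N)%N by apply: ltn_ord.
  have -> : q^-1 ^+ N = q^-1 ^+ (N - m.+1) * q^-1 ^+ m.+1 by rewrite -exprD subnK.
  have : q^-1 ^+ (N - m.+1) * q ^+ (N - m.+1) = 1.
    by rewrite -exprMn mulVf// expr1n.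
  have : q^-1 ^+ m.+1 * q ^+ m.+1 = 1 by rewrite -exprMn mulVf// expr1n.
  move: (q^-1 ^+ m.+1) (q ^+ m.+1) (q^-1 ^+ (N - _)) (q ^+ (N - _)).
  move=> a b c d ab cd.
  transitivity (- x * a + (x / x) * (a * b)); first by ring.
  rewrite divff// ab mul1r; transitivity (1 - x * a * (c * d)); last by ring.
  by rewrite cd; ring.
rewrite {}H.
have -> : (N + N.+1).+1 = (N.+1 + N.+1)%N by [].
rewrite big_split_ord /= (reindex_inj rev_ord_inj) /= -big_split /= mulr_sumr.
apply: eq_bigr => l _.
have lN : (l <= N)%N by rewrite -ltnS.
have -> : (N.+1 - l.+1 = N - l)%N by rewrite subSS.
have -> : qbin (N + N.+1) (N.+1 + l) = qbin (N + N.+1) (N - l).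
  have -> : (N + N.+1 = (N - l) + (N.+1 + l))%N by lia.
  exact: qbin_sym.
have expo a b c d : (a + d = c + b)%N -> q ^+ a * q^-1 ^+ b = q ^+ c * q^-1 ^+ d.
  move=> e; rewrite !exprVn; apply/eqP.
  by rewrite eqr_div ?qE// -!exprD e.
have triN := bin2_double N; have tril := bin2_double l.
have e1 := @expo 'C(N - l, 2) (N * (N - l))%N 'C(l.+1, 2) 'C(N.+1, 2) _.
have e2 := @expo 'C(N.+1 + l, 2) (N * (N.+1 + l))%N 'C(l.+1, 2) 'C(N.+1, 2) _.
rewrite !exprMn -!exprM.
transitivity (((-1) ^+ (N - l) * x ^+ (N - l) * (q ^+ 'C(N - l, 2) * q^-1 ^+ (N * (N - l)))
  + (-1) ^+ (N.+1 + l) * x ^+ (N.+1 + l) * (q ^+ 'C(N.+1 + l, 2) * q^-1 ^+ (N * (N.+1 + l)))) * qbin (N + N.+1) (N - l));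
  first by ring.
rewrite e1; last first.
  have : N = (l + (N - l))%N by rewrite subnKC.
  case: (N - l)%N => [|i] Nli; first by rewrite bin0n /=; nia.
  have := bin2_double i; nia.
rewrite e2; last first.
  by have := bin2_double (N + l); rewrite addSn; nia.
have sgn2 : (-1) ^+ l * (-1) ^+ l = 1 :> F by rewrite -exprMn mulrNN mulr1 expr1n.
have xl : x^-1 ^+ l * x ^+ l = 1 by rewrite -exprMn mulVf// expr1n.
have NE : N = (N - l + l)%N by rewrite subnK.
rewrite /kap [(- x) ^+ N]exprNn.
move: (q ^+ 'C(l.+1, 2)) (q^-1 ^+ 'C(N.+1, 2)) (qbin _ _) => A B D.
rewrite addSn !exprS !exprD [in x ^+ N]NE [in (-1) ^+ N]NE !exprD.
move: sgn2 xl.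
move: ((-1) ^+ l) ((-1) ^+ (N - l)) (x ^+ l) (x^-1 ^+ l) (x ^+ (N - l)) => s t u v w ss vu.
transitivity (t * w * A * B * D * ((v * u) - (s * s) * x * u * u)); last first.
  by transitivity (t * w * A * B * D * ((s * s) * (v * u) - (s * s) * x * u * u)); [rewrite ss !mul1r|ring].
by rewrite vu; ring.
Qed.

End GaussBinomial.

(** * Infinite products and the theta series *)

Section ThetaProduct.
Context {R : realType}.
Local Notation C := R[i].

Lemma eventually_bounded (v : nat -> C) (M : nat) (B : C) :
  (forall n, 0 <= v n) -> (forall n, (M <= n)%N -> v n <= B) ->
  exists2 K : C, 0 <= K & forall n, v n <= K.
Proof.
move=> v0 vB; have B0 : 0 <= B by apply: le_trans (vB M _).
exists (B + \sum_(l < M) v l); first by rewrite addr_ge0 ?sumr_ge0.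
move=> n; have [Mn|nM] := leqP M n.
  by rewrite (le_trans (vB n Mn))// lerDl sumr_ge0.
by rewrite (bigD1 (Ordinal nM))//= addrCA lerDl addr_ge0// sumr_ge0.
Qed.

Variable q : C.
Hypothesis q_lt1 : `|q| < 1.
Hypothesis q_neq0 : q != 0.

Lemma small_power (e : C) : 0 < e -> exists M, forall n, (M <= n)%N -> `|q| ^+ n <= e.
Proof.
move=> e0; pose r := complex.Re `|q|.
have qr : `|q| = r%:C%C by rewrite -ger0_complex.
have r0 : 0 <= r by rewrite ge0_Re.
have /cvg_expr/cvgrPdist_le/(_ _ (gt0_Re e0)) : `|r| < 1.
  by rewrite ger0_norm// -ltcR -qr.
move=> [M _ HM]; exists M => n /HM /=.
rewrite sub0r normrN ger0_norm ?exprn_ge0// -lecR rmorphXn /= -qr.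
by rewrite -ger0_complex// ltW.
Qed.

(** Once the remaining |u m| add up to at most 1/4, all further partial products
    stay within 1/2 of 1. *)
Lemma prod_bounds (u : nat -> C) (A : C) :
  (forall m, `|u m| <= A * `|q| ^+ m) ->
  exists M, forall N,
    [/\ `|\prod_(m < M) (1 - u m)| / 2 <= `|\prod_(m < M + N) (1 - u m)|
      & `|\prod_(m < M + N) (1 - u m)| <= `|\prod_(m < M) (1 - u m)| * 2].
Proof.
move=> uA; have A0 : 0 <= A by have := le_trans (normr_ge0 _) (uA 0%N); rewrite mulr1.
have q1 : 0 < 1 - `|q| by rewrite subr_gt0.
have half1 : 2^-1 <= 1 :> C by rewrite invf_le1// ler1n.
have half2 : 2 * 4^-1 = 2^-1 :> C by field.
have half_compl : 1 - 2^-1 = 2^-1 :> C by field.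
have [|M HM] := @small_power ((1 - `|q|) / (4 * (A + 1))).
  by rewrite divr_gt0// mulr_gt0// ltr_wpDl.
exists M => N.
have s_le i : \sum_(m < i) A * `|q| ^+ (M + m) <= 4^-1.
  rewrite -mulr_sumr (eq_bigr (fun m : 'I_i => `|q| ^+ M * `|q| ^+ m)); last first.
    by move=> m _; rewrite exprD.
  rewrite -mulr_sumr.
  have gs : \sum_(m < i) `|q| ^+ m <= (1 - `|q|)^-1.
    rewrite -[_^-1]mul1r ler_pdivlMr// mulrC.
    have -> : (1 - `|q|) * \sum_(m < i) `|q| ^+ m = 1 - `|q| ^+ i.
      by rewrite -[RHS]opprB subrX1 -mulNr opprB.
    by rewrite lerBlDr lerDl exprn_ge0.
  have h1 : A * (`|q| ^+ M * (1 - `|q|)^-1) <= 4^-1.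
    apply: le_trans (_ : A * (1 / (4 * (A + 1))) <= _).
      rewrite ler_wpM2l// ler_pdivrMr// mul1r mulrC; exact: HM.
    rewrite mul1r ler_pdivrMr ?mulr_gt0 ?ltr_wpDl// mulKf ?lerDl//.
  apply: le_trans h1; rewrite ler_wpM2l// ler_wpM2l// exprn_ge0//.
pose p i := \prod_(m < i) (1 - u (M + m)%N).
have pE : \prod_(m < M + N) (1 - u m) = \prod_(m < M) (1 - u m) * p N.
  by rewrite big_split_ord.
have p1 i : `|p i - 1| <= 2 * \sum_(m < i) A * `|q| ^+ (M + m).
  elim: i => [|i IH]; first by rewrite /p !big_ord0 subrr normr0 mulr0.
  rewrite /p big_ord_recr /= -/(p i) big_ord_recr /=.
  have -> : p i * (1 - u (M + i)%N) - 1 = (p i - 1) - p i * u (M + i)%N by ring.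
  apply: le_trans (ler_normB _ _) _; rewrite mulrDr lerD//.
  rewrite normrM ler_pM// -[p i](subrK 1).
  apply: le_trans (ler_normD _ _) _.
  rewrite normr1 -lerBrDr.
  apply: le_trans IH _.
  apply: le_trans (ler_wpM2l _ (s_le i)) _ => //.
  by rewrite half2 [2]mulr2n addrK.
have p2 : `|p N - 1| <= 2^-1.
  apply: le_trans (p1 N) _; apply: le_trans (ler_wpM2l _ (s_le N)) _ => //.
  by rewrite half2.
rewrite pE normrM; split; rewrite ler_wpM2l//.
  rewrite -{1}half_compl lerBlDr -lerBlDl.
  by apply: le_trans p2; rewrite -[X in X - _]normr1 distrC lerB_dist.
rewrite -[p N](subrK 1) (le_trans (ler_normD _ _))// normr1 [leRHS]mulr2n lerD2r.
exact: le_trans p2 half1.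
Qed.

Lemma prod_upper (u : nat -> C) (A : C) :
  (forall m, `|u m| <= A * `|q| ^+ m) ->
  exists2 K, 0 <= K & forall N, `|\prod_(m < N) (1 - u m)| <= K.
Proof.
move=> /prod_bounds[M HM].
apply: (@eventually_bounded _ M (`|\prod_(m < M) (1 - u m)| * 2)) => // n Mn.
by have [_] := HM (n - M)%N; rewrite subnKC.
Qed.

Lemma prod_lower (u : nat -> C) (A : C) :
  (forall m, `|u m| <= A * `|q| ^+ m) -> (forall m, 1 - u m != 0) ->
  exists2 K, 0 <= K & forall N, `|\prod_(m < N) (1 - u m)|^-1 <= K.
Proof.
move=> /prod_bounds[M HM] u0.
have P0 N : 0 < `|\prod_(m < N) (1 - u m)|.
  by rewrite normr_gt0; apply/prodf_neq0 => i _.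
apply: (@eventually_bounded _ M (`|\prod_(m < M) (1 - u m)| / 2)^-1) => // n Mn.
have [+ _] := HM (n - M)%N; rewrite subnKC// => h.
by rewrite lef_pV2// posrE ?divr_gt0 ?P0.
Qed.


Let qpow_bound m : `|q ^+ m.+1| <= `|q| * `|q| ^+ m.
Proof. by rewrite normrX exprS. Qed.

Lemma one_sub_qpow_neq0 m : 1 - q ^+ m.+1 != 0.
Proof.
rewrite subr_eq0 eq_sym; apply/eqP => qm1.
have : `|q| ^+ m.+1 < 1 by rewrite exprn_ilt1.
by rewrite -normrX qm1 normr1 ltxx.
Qed.

Lemma qfact_neq0 N : qfact q N != 0.
Proof. by apply/prodf_neq0 => i _; apply: one_sub_qpow_neq0. Qed.

Lemma qfact_upper : exists2 K, 0 <= K & forall N, `|qfact q N| <= K.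
Proof. exact: (@prod_upper (fun m => q ^+ m.+1) _ qpow_bound). Qed.

Lemma qfact_lower : exists2 K, 0 <= K & forall N, `|qfact q N|^-1 <= K.
Proof.
exact: (@prod_lower (fun m => q ^+ m.+1) _ qpow_bound one_sub_qpow_neq0).
Qed.

(** The products converge at a geometric rate, because the increment at step
    m is at most B |q|^m. *)
Lemma qfact_tail : exists2 K, 0 <= K &
  forall m i, `|qfact q (m + i) - qfact q m| <= K * `|q| ^+ m.
Proof.
have [B B0 HB] := qfact_upper.
have q1 : 0 < 1 - `|q| by rewrite subr_gt0.
exists (B / (1 - `|q|)); first by rewrite divr_ge0// ltW.
move=> m i; apply: (@le_trans _ _ (B / (1 - `|q|) * `|q| ^+ m * (1 - `|q| ^+ i))).
  elim: i => [|i IH]; first by rewrite addn0 expr0 !subrr normr0 mulr0.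
  have -> : qfact q (m + i.+1) - qfact q m =
    (qfact q (m + i) - qfact q m) - qfact q (m + i) * q ^+ (m + i).+1.
    by rewrite addnS qfactS; ring.
  apply: le_trans (ler_normB _ _) _.
  have h : `|qfact q (m + i) * q ^+ (m + i).+1| <= B * `|q| ^+ (m + i).
    rewrite normrM normrX ler_pM ?exprn_ge0//.
    by rewrite exprS ler_piMl ?exprn_ge0// ltW.
  apply: le_trans (lerD IH h) _; rewrite le_eqVlt; apply/orP; left; apply/eqP.
  by rewrite exprD exprS; field; rewrite lt0r_neq0.
apply: ler_piMr; first by rewrite mulr_ge0 ?exprn_ge0// divr_ge0// ltW.
by rewrite lerBlDr lerDl exprn_ge0.
Qed.

Definition theta_coef (l : nat) : C := (-1) ^+ l * q ^+ 'C(l.+1, 2).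

(** The ratio of consecutive terms is |q|^(l + 1) r, eventually at most 1. *)
Lemma theta_coef_rapid : rapid_decay theta_coef.
Proof.
move=> r r0; pose v l := `|theta_coef l| * r ^+ l.
have r1 : 0 < r + 1 by rewrite ltr_wpDl.
have [|M HM] := @small_power (r + 1)^-1; first by rewrite invr_gt0.
have v0 l : 0 <= v l by rewrite mulr_ge0 ?exprn_ge0.
apply: (@eventually_bounded v M (v M)) => // n /subnKC <-.
elim: (n - M)%N => [|i IH]; first by rewrite addn0.
apply: le_trans IH; rewrite addnS; set l := (M + i)%N.
have -> : v l.+1 = v l * (`|q| ^+ l.+1 * r).
  rewrite /v /theta_coef !normrM !normrX normrN1 !expr1n !mul1r.
  by rewrite (binS l.+1 1) bin1 exprD [r ^+ l.+1]exprS; ring.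
rewrite ler_piMr//.
apply: le_trans (ler_wpM2r r0 (HM l.+1 _)) _; first by rewrite ltnW// ltnS leq_addr.
by rewrite mulrC ler_pdivrMr// mul1r lerDl.
Qed.

(** theta as a function of x = e(z): the terms of index - l of the bilateral
    series make up the first power series, those of index l + 1 the second. *)
Definition theta_x (x : C) : C :=
  power_series theta_coef x^-1 - x * power_series theta_coef x.

Lemma theta_x_cvg x :
  (\sum_(l < N) theta_coef l * (x^-1 ^+ l - x ^+ l.+1) : C^o) @[N --> \oo]
    --> (theta_x x : C^o).
Proof.
have h := cvgB (@power_series_cvg _ _ x^-1 theta_coef_rapid)
   (cvgMl_tmp (a := (x : C^o)) (@power_series_cvg _ _ x theta_coef_rapid)).
rewrite (_ : (fun N => _) = (fun N => \sum_(l < N) theta_coef l * x^-1 ^+ l -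
   x * \sum_(l < N) theta_coef l * x ^+ l)); first exact: h.
apply/funext => N; rewrite mulr_sumr -sumrB; apply: eq_bigr => l _.
by rewrite exprS; ring.
Qed.

Lemma theta_x1 : theta_x 1 = 0.
Proof. by rewrite /theta_x invr1 mul1r subrr. Qed.

Lemma theta_xV x : x != 0 -> theta_x x^-1 = - x^-1 * theta_x x.
Proof.
by move=> x0; rewrite /theta_x invrK; field.
Qed.

(** A shift of the summation index by one. *)
Lemma theta_series_shift x :
  power_series theta_coef x = 1 - q * x * power_series theta_coef (q * x).
Proof.
have h1 := @power_series_cvg _ _ x theta_coef_rapid.
have h2 := @power_series_cvg _ _ (q * x) theta_coef_rapid.
move: h1; rewrite -(cvg_shiftS (fun N => \sum_(l < N) theta_coef l * x ^+ l : C^o)) => h1.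
have h3 := cvgB (cvg_cst (1 : C^o)) (cvgMl_tmp (a := (q * x : C^o)) h2).
apply: (norm_cvg_unique h1).
rewrite (_ : (fun N => _) = (fun N => 1 - (q * x) * \sum_(l < N) theta_coef l * (q * x) ^+ l)); first exact: h3.
apply/funext => N.
rewrite big_ord_recl /= {1}/theta_coef !expr0 !mulr1; congr (_ + _).
rewrite mulr_sumr -sumrN; apply: eq_bigr => l _.
by rewrite /bump leq0n add1n /theta_coef binS bin1 exprD exprMn !exprS; ring.
Qed.

Lemma theta_x_shift x : x != 0 -> theta_x (q * x) = - x^-1 * theta_x x.
Proof.
move=> x0; rewrite /theta_x.
have -> : q * x * power_series theta_coef (q * x) = 1 - power_series theta_coef x.
  by rewrite (theta_series_shift x); ring.
have -> : power_series theta_coef (q * x)^-1 = 1 - x^-1 * power_series theta_coef x^-1.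
  rewrite (theta_series_shift (q * x)^-1).
  by rewrite invfM mulVKf.
by field.
Qed.

End ThetaProduct.

(** * Zeros of theta in the variable x *)

Section ThetaNonvanishing.
Context {R : realType}.
Local Notation C := R[i].
Variable q : C.
Hypothesis q_lt1 : `|q| < 1.
Hypothesis q_neq0 : q != 0.
(* The finite triple product divided by its central Gaussian binomial is the
   truncated theta series with weights w N l; these tend to 1. *)
Variable x : C.
Hypothesis x_neq0 : x != 0.

Let tc := theta_coef q.
Let w N l := qfact q N * qfact q N.+1 / (qfact q (N - l) * qfact q (N.+1 + l)).
Let term l := tc l * (x^-1 ^+ l - x ^+ l.+1).
Let P N := (1 - x) * (\prod_(m < N) (1 - x * q ^+ m.+1)
                      * \prod_(m < N) (1 - x^-1 * q ^+ m.+1)).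
Let F N := P N * (qfact q N * qfact q N.+1) / qfact q (N + N.+1).

Lemma truncation_sum N : F N = \sum_(l < N.+1) term l * w N l.
Proof.
have qf := qfact_neq0 q_lt1.
rewrite /F /P finite_triple_product// !mulr_suml; apply: eq_bigr => l _.
have lN : (l <= N)%N by rewrite -ltnS.
have e : (N + N.+1 = (N - l) + (N.+1 + l))%N by lia.
have := qbin_qfact q (N - l) (N.+1 + l); rewrite -e => h.
rewrite /term /w /tc /theta_coef -h; field.
rewrite !qf /=; apply: contraNneq (qf (N + N.+1)%N) => h0.
by rewrite -h h0 mul0r.
Qed.

Lemma weight_bound : exists2 D, 0 <= D &
  forall N l, (l <= N)%N -> `|w N l - 1| <= D * `|q| ^+ (N - l).
Proof.
have qf := qfact_neq0 q_lt1.
have [B B0 HB] := qfact_upper q_lt1.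
have [b b0 Hb] := qfact_lower q_lt1.
have [t t0 Ht] := qfact_tail q_lt1.
exists (2 * B * t * (b * b)); first by rewrite !mulr_ge0.
move=> N l lN.
have -> : w N l - 1 = (qfact q (N - l + l) - qfact q (N - l)) * qfact q N.+1
      / (qfact q (N - l) * qfact q (N.+1 + l))
    - qfact q (N - l) * (qfact q (N.+1 + l) - qfact q N.+1)
      / (qfact q (N - l) * qfact q (N.+1 + l)).
  by rewrite subnK// /w; field; rewrite !qf.
have inv_le : `|(qfact q (N - l) * qfact q (N.+1 + l))^-1| <= b * b.
  by rewrite normfV normrM invfM ler_pM ?invr_ge0.
have h1 := Ht (N - l)%N l.
have h2 : `|qfact q (N.+1 + l) - qfact q N.+1| <= t * `|q| ^+ (N - l).
  apply: le_trans (Ht N.+1 l) _; rewrite ler_wpM2l// ler_wiXn2l ?(ltW q_lt1)//.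
  by rewrite leqW// leq_subr.
have tq0 : 0 <= t * `|q| ^+ (N - l) by rewrite mulr_ge0 ?exprn_ge0.
apply: le_trans (ler_normB _ _) _; rewrite [`|_ / _|]normrM [`|_ * (_ - _) / _|]normrM.
have -> : 2 * B * t * (b * b) * `|q| ^+ (N - l) =
   (t * `|q| ^+ (N - l) * B) * (b * b) + (B * (t * `|q| ^+ (N - l))) * (b * b) by ring.
by rewrite lerD// ler_pM// normrM ler_pM.
Qed.

(** The weight of index l is off by O(|q|^(N - l)), and rapid decay of the
    coefficients compensates for the loss of |q|^(- l). *)
Lemma truncation_error : exists2 E, 0 <= E &
  forall N, `|F N - \sum_(l < N.+1) term l| <= E * `|q| ^+ N.
Proof.
have [D D0 HD] := weight_bound.
pose X := `|x| + `|x^-1| + 1.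
have X0 : 0 <= X by rewrite !addr_ge0.
have X1 : 1 <= X by rewrite lerDr addr_ge0.
have nq : `|q| != 0 by rewrite normr_eq0.
have [|K K0 HK] := rapid_decay_terms (theta_coef_rapid q_lt1) (r := X / `|q|).
  by rewrite divr_ge0.
exists (2 * (2 * X * D * K)); first by rewrite !mulr_ge0.
move=> N; rewrite truncation_sum -sumrB -[2 * (2 * X * D * K) * _]mulrA.
apply: (@geometric_sum_le _ (fun l => term l * w N l - term l)).
  by rewrite !mulr_ge0 ?exprn_ge0.
move=> l; rewrite ltnS => lN.
have -> : term l * w N l - term l = term l * (w N l - 1) by ring.
have tl : `|term l| <= `|tc l| * (2 * X ^+ l.+1).
  rewrite normrM ler_wpM2l//; apply: le_trans (ler_normB _ _) _.
  rewrite !normrX [2]mulr2n mulrDl mul1r lerD//.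
    apply: le_trans (_ : X ^+ l <= _); last by rewrite ler_weXn2l.
    by rewrite lerXn2r// ?nnegrE// /X addrAC lerDr addr_ge0.
  by rewrite lerXn2r// ?nnegrE// /X -addrA lerDl addr_ge0.
rewrite normrM; apply: le_trans (ler_pM _ _ tl (HD N l lN)) _ => //.
have Xq : `|X / `|q| | = X / `|q| by rewrite ger0_norm ?divr_ge0.
have := HK (X / `|q|) l; rewrite Xq => /(_ (lexx _)); rewrite normrM normrX Xq => h.
have -> : `|tc l| * (2 * X ^+ l.+1) * (D * `|q| ^+ (N - l)) =
   2 * X * D * (`|tc l| * (X / `|q|) ^+ l) * `|q| ^+ N.
  rewrite -[in RHS](subnK lN) exprD expr_div_n exprS; field.
  by rewrite expf_neq0.
rewrite [leRHS]mulrAC ler_wpM2r ?exprn_ge0// -[leRHS]mulrA ler_wpM2l ?mulr_ge0//.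
Qed.

(** The truncations F N converge to theta, and the inverses of their norms
    are bounded because each is a product of finitely many bounded families of
    nonzero factors. *)
Lemma theta_x_neq0 : (forall m, x * q ^+ m != 1) ->
  (forall m, x^-1 * q ^+ m.+1 != 1) -> theta_x q x != 0.
Proof.
move=> xq xVq.
have qf := qfact_neq0 q_lt1.
have x1 : 1 - x != 0 by rewrite subr_eq0 eq_sym -[x]mulr1 -(expr0 q).
have bnd y m : `|y * q ^+ m.+1| <= `|y| * `|q| * `|q| ^+ m.
  by rewrite normrM normrX exprS mulrA.
have [|b1 b10 Hb1] := @prod_lower _ _ q_lt1 (fun m => x * q ^+ m.+1) _ (bnd x).
  by move=> m; rewrite subr_eq0 eq_sym.
have [|b2 b20 Hb2] := @prod_lower _ _ q_lt1 (fun m => x^-1 * q ^+ m.+1) _ (bnd x^-1).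
  by move=> m; rewrite subr_eq0 eq_sym.
have [b b0 Hb] := qfact_lower q_lt1.
have [B B0 HB] := qfact_upper q_lt1.
have [E E0 HE] := truncation_error.
pose G := `|1 - x|^-1 * (b1 * b2) * (b * b) * B.
have G0 : 0 <= G by rewrite !mulr_ge0// invr_ge0.
have FG N : `|F N|^-1 <= G.
  rewrite /F /P !normrM normfV !invfM invrK /G.
  by rewrite !ler_pM ?mulr_ge0 ?invr_ge0.
apply/eqP => th0.
have := @theta_x_cvg _ q q_lt1 x.
rewrite -(cvg_shiftS (fun N => \sum_(l < N) theta_coef q l * (x^-1 ^+ l - x ^+ l.+1) : C^o)) th0.
(* If theta were 0 at x, both the partial sum and the truncation error would
   get below half of 1 / (G + 1), while the norm of F N is at least 1 / G. *)
have e0 : 0 < (2 * (G + 1))^-1 by rewrite invr_gt0 mulr_gt0// ltr_wpDl.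
move=> /cvgrPdist_le/(_ _ e0)[N1 _ HN1].
have [|N2 HN2] := @small_power _ q q_lt1 ((2 * (G + 1))^-1 / (E + 1)).
  by rewrite divr_gt0// ltr_wpDl.
pose N := maxn N1 N2.
have /= := HN1 N (leq_maxl _ _); rewrite sub0r normrN => h1.
have := HN2 N (leq_maxr _ _); rewrite ler_pdivlMr ?ltr_wpDl// => h2.
have FN : `|F N| <= (G + 1)^-1.
  rewrite -[F N](subrK (\sum_(l < N.+1) term l)).
  apply: le_trans (ler_normD _ _) _; apply: le_trans (lerD (HE N) h1) _.
  have : E * `|q| ^+ N <= (2 * (G + 1))^-1.
    apply: le_trans h2; rewrite mulrC ler_wpM2l ?exprn_ge0// lerDl//.
  move=> h3; apply: le_trans (lerD h3 (lexx _)) _.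
  rewrite le_eqVlt; apply/orP; left; apply/eqP; field.
  by rewrite lt0r_neq0// ltr_wpDl.
have FN0 : 0 < `|F N|.
  rewrite normr_gt0 !mulf_neq0 ?invr_neq0//.
  - by apply/prodf_neq0 => i _; rewrite subr_eq0 eq_sym.
  - by apply/prodf_neq0 => i _; rewrite subr_eq0 eq_sym.
have : G + 1 <= `|F N|^-1.
  rewrite -[G + 1]invrK lef_pV2 ?posrE ?invr_gt0//.
  by rewrite ltr_wpDl.
by move=> /le_trans/(_ (FG N)); rewrite gerDl ler10.
Qed.

End ThetaNonvanishing.

(** * The function theta *)

Section Ezp.
Context {R : realType}.
Local Notation C := R[i].
Implicit Types z w : C.

Lemma ezpD z w : ezp (z + w) = ezp z * ezp w.
Proof. by rewrite /ezp mulrDr expCD. Qed.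

Lemma ezp0 : ezp 0 = 1 :> C.
Proof. by rewrite /ezp mulr0 expC0. Qed.

Lemma ezp_neq0 z : ezp z != 0. Proof. exact: expC_neq0. Qed.

Lemma ezpN z : ezp (- z) = (ezp z)^-1.
Proof. by rewrite /ezp mulrN expCN. Qed.

Lemma ezpMn (m : nat) z : ezp (m%:R * z) = ezp z ^+ m.
Proof.
elim: m => [|m IH]; first by rewrite mul0r ezp0.
by rewrite -natr1 mulrDl mul1r ezpD IH exprSr.
Qed.

Lemma ezp_arg z : 2 * (pi : R)%:C%C * 'i%C * z =
  ((- (2 * pi * complex.Im z)) +i* (2 * pi * complex.Re z))%C.
Proof.
have -> : (2 : C) = (2 : R)%:C%C by rewrite rmorph_nat.
by case: z => a b; apply/eqP; rewrite eq_complex /=; apply/andP; split; apply/eqP; ring.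
Qed.

Lemma norm_ezp z : `|ezp z| = (expR (- (2 * pi * complex.Im z)))%:C%C.
Proof. by rewrite norm_expC ezp_arg. Qed.

Lemma ezp1 : ezp 1 = 1 :> C.
Proof.
rewrite /ezp ezp_arg /= mulr0 mulr1 /expC /= oppr0 expR0 mul1r mulr_natl cos2pi sin2pi.
by [].
Qed.

Lemma ezp_half : ezp 2^-1 = -1 :> C.
Proof.
have -> : (2^-1 : C) = (2^-1 : R)%:C%C by rewrite fmorphV rmorph_nat.
rewrite /ezp ezp_arg /= mulr0 /expC /= oppr0 expR0 mul1r.
have -> : 2 * pi / 2 = pi :> R by field.
rewrite cospi sinpi; apply/eqP.
by rewrite eq_complex /= oppr0 !eqxx.
Qed.

Lemma ezp_Nhalf : ezp (- 2^-1) = -1 :> C.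
Proof. by rewrite ezpN ezp_half invrN1. Qed.

Lemma ezp_int (m : int) : ezp m%:~R = 1 :> C.
Proof.
have h k : ezp k%:R = 1 :> C by rewrite -[k%:R]mulr1 ezpMn ezp1 expr1n.
by case: m => k; rewrite ?NegzE ?mulrNz ?ezpN -pmulrn h// invr1.
Qed.

(** The norm of e(z) forces z to be real; if t is its fractional part, then
    cos (2 pi t) = 1 forces sin (pi t) = 0, and sin is positive on ]0, pi[. *)
Lemma ezp_eq1 z : ezp z = 1 -> exists m : int, z = m%:~R.
Proof.
move=> z1.
have imz : complex.Im z = 0.
  have := norm_ezp z; rewrite z1 normr1 => /(congr1 (@complex.Re R))/= /esym/eqP.
  rewrite -[X in _ == X]expR0 => /eqP/expR_inj/eqP; rewrite oppr_eq0 !mulf_eq0 pnatr_eq0/=.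
  by rewrite gt_eqF ?pi_gt0//= => /eqP.
exists (Num.floor (complex.Re z)).
pose t : R := complex.Re z - (Num.floor (complex.Re z))%:~R.
have t01 : 0 <= t < 1.
  have := Num.Theory.floor_itv (complex.Re z).
  by rewrite /t subr_ge0 ltrBlDl intrD => /andP[-> ->].
have ezt : ezp t%:C%C = 1.
  have -> : t%:C%C = z - (Num.floor (complex.Re z))%:~R.
    rewrite /t rmorphB /= rmorph_int; congr (_ - _).
    by case: (z) imz => a b /= ->.
  by rewrite ezpD z1 ezpN ezp_int invr1 mulr1.
have := congr1 (@complex.Re R) ezt; rewrite /ezp ezp_arg /= !mulr0 oppr0 /expC /= expR0 mul1r mul0r subr0.
move=> cos1.
have t0 : t = 0.
  have [t0 t1] := andP t01; apply/eqP; apply: contraPT cos1 => tN0.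
  have : 0 < sin (pi * t).
    rewrite sin_gt0_pi// mulr_gt0 ?pi_gt0 ?lt0r ?tN0//=.
    by rewrite -[ltRHS]mulr1 ltr_pM2l ?pi_gt0.
  have -> : 2 * pi * t = (pi * t) *+ 2 by rewrite mulr2n; ring.
  rewrite cos_mulr2n cos2sin2 => s0 /eqP; apply/negP.
  rewrite lt_eqF// -subr_gt0.
  have -> : 1 - ((1 - sin (pi * t) ^+ 2) *+ 2 - 1) = sin (pi * t) ^+ 2 *+ 2.
    by rewrite !mulr2n; ring.
  by rewrite pmulrn_lgt0// exprn_gt0.
move: t0 => /eqP; rewrite subr_eq0 => /eqP t0.
by rewrite [LHS]complexE imz rmorph0 mulr0 addr0 [in LHS]t0 rmorph_int.
Qed.

Lemma holo_ezp z : holo (@ezp R) z.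
Proof.
set k := 2 * (pi : R)%:C%C * 'i%C.
exact (@holo_comp R (fun z => k * z) (@expC R) z
  (@holoM R (fun=> k) id z (@holo_cst R k z) (@holo_id R z)) (@holo_expC R _)).
Qed.

Lemma ezp_double_half w (j : int) : ezp ((j * 2)%:~R / 2 * w) = ezp (j%:~R * w).
Proof. by rewrite intrM -pmulrn mulfK// pnatr_eq0. Qed.

(** The automorphy factors of theta at N consecutive translates by 1 / N: the
    arguments add up to N w + (N - 1) / 2, and the half-integer part cancels
    the sign up to - 1. *)
Lemma prod_oppV_ezp (N : nat) w : (0 < N)%N ->
  \prod_(0 <= m < N) - (ezp (w + m%:R / N%:R))^-1 = - ezp (- (N%:R * w)).
Proof.
move=> N0; have N00 : N%:R != 0 :> C by rewrite pnatr_eq0 -lt0n.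
have h (c : C) M : \prod_(0 <= m < M) - (ezp (w + m%:R * c))^-1 =
    (-1) ^+ M * ezp (- (M%:R * w + 'C(M, 2)%:R * c)).
  elim: M => [|M IH]; first by rewrite big_geq// !mul0r addr0 oppr0 ezp0 mulr1.
  rewrite big_nat_recr//= IH exprSr -ezpN -[M.+1%:R]natr1 binS bin1 natrD.
  set E1 := ezp _; set E2 := ezp _.
  transitivity ((-1) ^+ M * -1 * (E1 * E2)); first by ring.
  by rewrite -ezpD; congr (_ * ezp _); ring.
rewrite (eq_bigr (fun m : nat => - (ezp (w + m%:R * N%:R^-1))^-1))// h.
have -> : - (N%:R * w + 'C(N, 2)%:R / N%:R) = - (N%:R * w) - N.-1%:R * 2^-1.
  rewrite -[N]prednK// [RHS]addrC opprD [RHS]addrC; congr (_ - _).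
  have /(congr1 (fun k : nat => k%:R : C)) := bin2_double N.-1.
  rewrite !natrM prednK// => e; apply: (mulIf (_ : 2 != 0 :> C)); first by rewrite pnatr_eq0.
  rewrite mulrAC e; field.
  by rewrite N00.
rewrite ezpD !ezpN [ezp (N.-1%:R * _)]ezpMn ezp_half.
rewrite -[in (-1) ^+ N](prednK N0) exprS; set s := (-1) ^+ _.
have s0 : s != 0 by rewrite expf_neq0// oppr_eq0 oner_eq0.
by field; rewrite s0 ezp_neq0.
Qed.

End Ezp.

Section Theta.
Context {R : realType}.
Local Notation C := R[i].
Variable eta : C.
Hypothesis eta_im : 0 < complex.Im eta.
Implicit Types z w : C.
Let q := ezp eta.

Lemma norm_nome_lt1 : `|q| < 1.
Proof.
rewrite norm_ezp (_ : 1 = (1 : R)%:C%C)// ltcR -expR0 ltr_expR oppr_lt0.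
by rewrite !mulr_gt0// pi_gt0.
Qed.
Let q1 := norm_nome_lt1.

Lemma theta_term_neg z (l : nat) :
  theta_term eta z (- l%:Z) = theta_coef q l * (ezp z)^-1 ^+ l.
Proof.
rewrite /theta_term /theta_coef -invr_expz -exprnP invr_sign -[RHS]mulrA; congr (_ * _).
have -> : - l%:Z * (- l%:Z - 1) = 'C(l.+1, 2)%:Z * 2.
  by have := bin2_double l; lia.
rewrite ezpD ezp_double_half -pmulrn ezpMn mulrC; congr (_ * _).
by rewrite mulrNz mulNr ezpN -pmulrn ezpMn exprVn.
Qed.

Lemma theta_term_pos z (l : nat) :
  theta_term eta z l.+1%:Z = - (theta_coef q l * ezp z ^+ l.+1).
Proof.
rewrite /theta_term /theta_coef -exprnP exprS mulN1r !mulNr -[in RHS]mulrA.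
congr (- (_ * _)).
have -> : l.+1%:Z * (l.+1%:Z - 1) = 'C(l.+1, 2)%:Z * 2.
  by have := bin2_double l; lia.
by rewrite ezpD ezp_double_half -!pmulrn !ezpMn mulrC.
Qed.

(** The index - l is paired with l + 1, which leaves - N alone. *)
Lemma theta_partial_sum z N :
  \sum_(0 <= l < N.*2.+1) theta_term eta z (l%:Z - N%:Z) =
  theta_coef q N * (ezp z)^-1 ^+ N
  + \sum_(l < N) theta_coef q l * ((ezp z)^-1 ^+ l - ezp z ^+ l.+1).
Proof.
elim: N => [|N IH].
  by rewrite big_nat1 big_ord0 addr0 -theta_term_neg !oppr0 ?addr0.
rewrite doubleS big_nat_recl// sub0r theta_term_neg; congr (_ + _).
rewrite (eq_bigr (fun l : nat => theta_term eta z (l%:Z - N%:Z))); last first.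
  by move=> l _; congr theta_term; lia.
rewrite big_nat_recr//= IH big_ord_recr /=.
have -> : N.*2.+1%:Z - N%:Z = N.+1%:Z by lia.
by rewrite theta_term_pos; ring.
Qed.

Lemma thetaE z : theta eta z = theta_x q (ezp z).
Proof.
have E : (fun N : nat => \sum_(0 <= l < N.*2.+1) theta_term eta z (l%:Z - N%:Z))
  = (fun N : nat => theta_coef q N * (ezp z)^-1 ^+ N
  + \sum_(l < N) theta_coef q l * ((ezp z)^-1 ^+ l - ezp z ^+ l.+1)).
  by apply/funext => N; apply: theta_partial_sum.
have [K K0 HK] := rapid_decay_terms (theta_coef_rapid q1) (normr_ge0 (ezp z)^-1).
have tail : (theta_coef q N * (ezp z)^-1 ^+ N : C^o) @[N --> \oo] --> (0 : C^o).
  apply/cvgrPdist_le => e e0.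
  have half1 : `|2^-1 : C| < 1 by rewrite ger0_norm ?invr_ge0// invf_lt1// ltr1n.
  have [|M HM] := @small_power R 2^-1 half1 (e / (K + 1)).
    by rewrite divr_gt0// ltr_wpDl.
  exists M => // N /HM /=; rewrite sub0r normrN ger0_norm ?invr_ge0// => h.
  apply: le_trans (HK _ N (lexx _)) _.
  apply: le_trans (ler_wpM2l K0 h) _.
  rewrite mulrA ler_pdivrMr ?ltr_wpDl// mulrC ler_wpM2l ?(ltW e0)//.
  by rewrite lerDl.
have := cvgD tail (@theta_x_cvg R q q1 (ezp z)); rewrite add0r => h.
rewrite /theta E; exact (cvg_lim (@norm_hausdorff _ (C^o)) (h _)).
Qed.

Lemma theta0 : theta eta 0 = 0.
Proof. by rewrite thetaE ezp0 theta_x1. Qed.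

Lemma thetaD1 z : theta eta (z + 1) = theta eta z.
Proof. by rewrite !thetaE ezpD ezp1 mulr1. Qed.

Lemma thetaDeta z : theta eta (z + eta) = - (ezp z)^-1 * theta eta z.
Proof. by rewrite !thetaE ezpD mulrC theta_x_shift// ezp_neq0. Qed.

Lemma thetaN z : theta eta (- z) = - (ezp z)^-1 * theta eta z.
Proof. by rewrite !thetaE ezpN theta_xV// ezp_neq0. Qed.

(** A zero would make one of the factors 1 - x q^m or 1 - q^(m + 1) / x vanish,
    and e takes the value 1 only at integers. *)
Lemma theta_eq0 z : theta eta z = 0 -> Lambda eta z.
Proof.
rewrite thetaE => /eqP; apply: contraTP => zL.
apply: theta_x_neq0; rewrite ?ezp_neq0//.
- move=> m; apply/eqP; rewrite -ezpMn -ezpD => /ezp_eq1[a za].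
  by apply: zL; exists a, (- m%:Z); rewrite -za mulrNz mulNr -pmulrn addrK.
- move=> m; apply/eqP; rewrite -ezpMn -ezpN -ezpD => /ezp_eq1[a za].
  apply: zL; exists (- a), m.+1%:Z; rewrite mulrNz -za -pmulrn.
  by ring.
Qed.

Lemma holo_theta z : holo (theta eta) z.
Proof.
rewrite (_ : theta eta = fun z => theta_x q (ezp z)); last exact/funext/thetaE.
have pow w : holo (power_series (theta_coef q)) w.
  by apply: power_series_holo; apply: theta_coef_rapid.
have hV : holo (fun z => (ezp z)^-1) z.
  exact (@holoV R _ z (ezp_neq0 z) (@holo_ezp R z)).
have hN : holo (fun z => - ezp z) z by exact (@derivableN _ _ _ _ _ _ (@holo_ezp R z)).
have h1 := @holo_comp R (fun z => (ezp z)^-1) (power_series (theta_coef q)) z hV (pow _).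
have h2 := @holoM R (fun z => - ezp z) _ z hN
   (@holo_comp R (@ezp R) (power_series (theta_coef q)) z (@holo_ezp R z) (pow _)).
rewrite (_ : (fun z => _) = (fun w => power_series (theta_coef q) (ezp w)^-1
  + - ezp w * power_series (theta_coef q) (ezp w))).
  exact (@holoD R _ _ z h1 h2).
by apply/funext => w; rewrite /theta_x mulNr.
Qed.

End Theta.

(** * The theta functions of level n *)

Section ThetaLevel.
Context {R : realType}.
Local Notation C := R[i].
Variables (eta : C) (n : nat).
Hypothesis eta_im : 0 < complex.Im eta.
Hypothesis n_gt1 : (1 < n)%N.
Implicit Types (z w : C) (a b : int).

Let n0 : n%:R != 0 :> C.
Proof. by rewrite pnatr_eq0; lia. Qed.

Let n_gt0 : (0 < n)%N. Proof. exact: ltnW. Qed.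

Let shift a z : C := z + a%:~R / n%:R * eta.

Lemma theta_levelE a z : theta_ eta n a z =
  ezp (a%:~R * z + a%:~R / (2 * n%:R) + (a * (a - n%:Z))%:~R / (2 * n%:R) * eta)
  * \prod_(0 <= m < n) theta eta (shift a z + m%:R / n%:R).
Proof.
rewrite /theta_; congr (_ * _); apply: eq_bigr => m _.
by congr theta; rewrite /shift addrAC.
Qed.

Lemma prod_theta_factor (f : C -> C) w :
  \prod_(0 <= m < n) (- (ezp (w + m%:R / n%:R))^-1 * f (w + m%:R / n%:R)) =
  - ezp (- (n%:R * w)) * \prod_(0 <= m < n) f (w + m%:R / n%:R).
Proof. by rewrite big_split /= prod_oppV_ezp. Qed.

(** Each of the n factors is translated by eta, and the prefactor is chosen to
    cancel the product of the automorphy factors. *)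
Lemma theta_levelDn a z : theta_ eta n (a + n%:Z) z = theta_ eta n a z.
Proof.
rewrite !theta_levelE.
rewrite (eq_bigr (fun m : nat => - (ezp (shift a z + m%:R / n%:R))^-1
    * theta eta (shift a z + m%:R / n%:R))); last first.
  move=> m _; rewrite -thetaDeta//; congr theta.
  by rewrite /shift intrD -pmulrn; field.
rewrite prod_theta_factor mulrA; congr (_ * _).
rewrite [LHS]mulrN -ezpD -mulN1r -ezp_Nhalf -ezpD.
congr ezp; rewrite /shift !(intrD, intrM, mulrNz) -!pmulrn; field.
by rewrite n0.
Qed.

Lemma theta_level_congr a b : (n%:Z %| a - b)%Z -> theta_ eta n a = theta_ eta n b.
Proof.
move=> /dvdzP[c ab]; apply/funext => z.
have -> : a = b + c * n%:Z by rewrite -ab addrC subrK.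
have h (k : nat) d : theta_ eta n (d + k%:Z * n%:Z) z = theta_ eta n d z.
  elim: k => [|k IH]; first by rewrite mul0r addr0.
  by rewrite (_ : d + k.+1%:Z * n%:Z = d + k%:Z * n%:Z + n%:Z) ?theta_levelDn//; lia.
case: c {ab} => k; first exact: h.
rewrite -(h k.+1 (b + Negz k * n%:Z)) (_ : _ + _ + _ = b)//.
by rewrite NegzE mulNr subrK.
Qed.

(** Reversing the order of the factors turns the translates of - z into the
    opposites of the translates of z, by periodicity. *)
Lemma theta_levelN a z :
  theta_ eta n (- a) (- z) = - ezp (- (n%:R * z) - a%:~R / n%:R) * theta_ eta n a z.
Proof.
rewrite !theta_levelE.
pose g (m : nat) := theta eta (- (shift a z + m%:R / n%:R)).
have gn : g n = g 0%N.
  rewrite /g divff// mul0r addr0 opprD -(thetaD1 eta_im (_ - 1)) subrK.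
  by [].
have -> : \prod_(0 <= m < n) theta eta (shift (- a) (- z) + m%:R / n%:R) =
    \prod_(0 <= m < n) g m.
  rewrite big_nat_rev /= add0n.
  transitivity (\prod_(0 <= m < n) g m.+1).
    rewrite !big_nat; apply: eq_bigr => m mn.
    rewrite /g -(thetaD1 eta_im (- _)); congr theta.
    rewrite /shift natrB//.
    by rewrite mulrNz -addn1 natrD; field.
  rewrite -[n]prednK// big_nat_recr//= [RHS]big_nat_recl//= mulrC prednK// gn.
  by [].
rewrite (eq_bigr (fun m : nat => - (ezp (shift a z + m%:R / n%:R))^-1
    * theta eta (shift a z + m%:R / n%:R))); last first.
  by move=> m _; rewrite /g thetaN.
rewrite prod_theta_factor [LHS]mulrA [RHS]mulrA; congr (_ * _).
rewrite [LHS]mulrN [RHS]mulNr -!ezpD; congr (- ezp _).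
rewrite /shift !(intrD, intrM, mulrNz) -!pmulrn; field.
by rewrite n0.
Qed.

Lemma theta_levelD1 a z : theta_ eta n a (z + 1) = theta_ eta n a z.
Proof.
rewrite !theta_levelE; congr (_ * _).
  rewrite mulrDr mulr1 -2!addrA addrCA ezpD ezp_int mul1r.
  by rewrite addrA.
apply: eq_bigr => m _; rewrite -[RHS]thetaD1//; congr theta.
by rewrite /shift; ring.
Qed.

(** The automorphy factor is the same for all indices, which is why the line of
    r_ij is periodic. *)
Lemma theta_levelDeta a z :
  theta_ eta n a (z + eta) = - ezp (- (n%:R * z)) * theta_ eta n a z.
Proof.
rewrite !theta_levelE.
rewrite (eq_bigr (fun m : nat => - (ezp (shift a z + m%:R / n%:R))^-1
    * theta eta (shift a z + m%:R / n%:R))); last first.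
  by move=> m _; rewrite -thetaDeta//; congr theta; rewrite /shift; ring.
rewrite prod_theta_factor [LHS]mulrA [RHS]mulrA; congr (_ * _).
rewrite [LHS]mulrN [RHS]mulNr -!ezpD; congr (- ezp _).
by rewrite /shift; field.
Qed.

Lemma theta_level0 : theta_ eta n 0 0 = 0.
Proof.
rewrite theta_levelE big_ltn// /shift !mul0r !addr0.
by rewrite theta0// mul0r mulr0.
Qed.

Lemma theta_level_zero a z : theta_ eta n a z = 0 ->
  exists A B, n%:R * z = A%:~R + B%:~R * eta /\ (n%:Z %| a + B)%Z.
Proof.
move=> /eqP; rewrite theta_levelE mulf_eq0 (negPf (ezp_neq0 _)) /=.
rewrite big_mkord => /prodf_eq0[m _ /eqP/theta_eq0-/(_ eta_im)[A [B AB]]].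
exists (A * n%:Z - m%:Z), (B * n%:Z - a); split.
  have -> : z = A%:~R + B%:~R * eta - m%:R / n%:R - a%:~R / n%:R * eta.
    by rewrite -AB /shift; ring.
  by rewrite !(intrD, intrM, mulrNz) -!pmulrn; field.
by rewrite addrC subrK dvdz_mull.
Qed.

Lemma int_span_inj A B A' B' :
  A%:~R + B%:~R * eta = A'%:~R + B'%:~R * eta :> C -> A = A' /\ B = B'.
Proof.
move=> e; have BB : B = B'.
  have := congr1 (@complex.Im R) e.
  rewrite -!(rmorph_int (real_complex R)).
  case: (eta) eta_im => u v /= v0; rewrite !mul0r !addr0 !add0r.
  by move=> /(mulIf (lt0r_neq0 v0))/eqP; rewrite eqr_int => /eqP.
split=> //; move: e; rewrite BB => /addIr/eqP; rewrite eqr_int => /eqP.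
by [].
Qed.

Lemma holo_theta_level a z : holo (theta_ eta n a) z.
Proof.
rewrite (_ : theta_ eta n a = fun z => ezp (a%:~R * z + (a%:~R / (2 * n%:R) +
  (a * (a - n%:Z))%:~R / (2 * n%:R) * eta)) * \prod_(m <- index_iota 0 n)
   theta eta (z + (m%:R / n%:R + a%:~R / n%:R * eta))); last first.
  apply/funext => w; rewrite /theta_ !addrA; congr (_ * _).
  by apply: eq_bigr => m _; rewrite addrA.
apply: holoM.
  apply: (@holo_comp R (fun z => _) (@ezp R)); last exact: holo_ezp.
  apply: holoD; last exact: holo_cst.
  by apply: holoM; [exact: holo_cst|exact: holo_id].
apply: holo_prod => m.
apply: (@holo_comp R (fun z => _) (theta eta)); last exact: holo_theta.
by apply: holoD; [exact: holo_id|exact: holo_cst].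
Qed.

End ThetaLevel.

(** * Level n theta functions indexed by Z/n *)

Section ThetaZ.
Context {R : realType}.
Local Notation C := R[i].
Variables (eta : C) (n : nat).
Hypothesis eta_im : 0 < complex.Im eta.
Hypothesis n_gt1 : (1 < n)%N.
Implicit Types (z : C) (a : 'Z_n) (m : int).

Lemma Zn_intr_eq0 m : (m%:~R == 0 :> 'Z_n) = (n%:Z %| m)%Z.
Proof.
have h k : (k%:R == 0 :> 'Z_n) = (n %| k)%N.
  by rewrite -val_eqE /= val_Zp_nat// mod0n.
by case: m => k; rewrite ?NegzE ?mulrNz ?oppr_eq0 ?dvdzN -pmulrn h.
Qed.

Lemma Zn_nat_intr a : ((a : nat)%:Z)%:~R = a.
Proof. by rewrite -pmulrn natr_Zp. Qed.

Lemma thetaZ_intr m : theta_ eta n m = thetaZ eta (m%:~R : 'Z_n).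
Proof.
apply: theta_level_congr => //.
by rewrite -Zn_intr_eq0 intrB Zn_nat_intr subrr.
Qed.

Lemma thetaZN a z : thetaZ eta (- a) (- z) =
  - ezp (- (n%:R * z) - (a : nat)%:R / n%:R) * thetaZ eta a z.
Proof.
have -> : - a = (- (a : nat)%:Z)%:~R by rewrite mulrNz Zn_nat_intr.
by rewrite -thetaZ_intr theta_levelN.
Qed.

Lemma thetaZN0 a : thetaZ eta (- a) 0 =
  - ezp (- ((a : nat)%:R / n%:R)) * thetaZ eta a 0.
Proof. by rewrite -[X in thetaZ _ _ X = _]oppr0 thetaZN mulr0 oppr0 add0r. Qed.

Lemma thetaZD1 a z : thetaZ eta a (z + 1) = thetaZ eta a z.
Proof. exact: theta_levelD1. Qed.

Lemma thetaZDeta a z :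
  thetaZ eta a (z + eta) = - ezp (- (n%:R * z)) * thetaZ eta a z.
Proof. exact: theta_levelDeta. Qed.

Lemma thetaZ00 : thetaZ eta (0 : 'Z_n) 0 = 0.
Proof. exact: theta_level0. Qed.

Lemma thetaZ_zero a z (A B : int) : n%:R * z = A%:~R + B%:~R * eta ->
  a != - B%:~R -> thetaZ eta a z != 0.
Proof.
move=> zAB; apply: contraNneq => /(theta_level_zero eta_im n_gt1)[A' [B' []]].
rewrite zAB => /(int_span_inj eta_im)[_ <-].
by rewrite -Zn_intr_eq0 intrD Zn_nat_intr addr_eq0.
Qed.

Lemma thetaZ_nontorsion a z : ~ torsion eta n z -> thetaZ eta a z != 0.
Proof.
move=> zt; apply/eqP => /(theta_level_zero eta_im n_gt1)[A [B [AB _]]].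
by apply: zt; exists A, B.
Qed.

Lemma thetaZ0_neq0 a : a != 0 -> thetaZ eta a 0 != 0.
Proof.
move=> a0; apply: (@thetaZ_zero _ _ 0 0); last by rewrite oppr0.
by rewrite mulr0 mul0r addr0.
Qed.

Lemma holo_thetaZ a z : holo (thetaZ eta a) z.
Proof. exact: holo_theta_level. Qed.

(** Two torsion points at distance less than min(1, Im eta) / n coincide, so at
    most one of them lies in a small ball around z0. *)
Lemma torsion_isolated z0 :
  \forall z \near (z0 : C^o), z = z0 \/ ~ torsion eta n z.
Proof.
have n0 : 0 < n%:R :> C by rewrite ltr0n ltnW.
pose e : C := (Num.min 1 (complex.Im eta))%:C%C / (2 * n%:R).
have e0 : 0 < e.
  by rewrite divr_gt0 ?mulr_gt0// (_ : 0 = (0 : R)%:C%C)// ltcR lt_min ltr01.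
have near_eq z z' : `|z - z'| < 2 * e -> torsion eta n z -> torsion eta n z' -> z = z'.
  move=> zz [A [B zAB]] [A' [B' zAB']].
  have h : n%:R * (z - z') = (A - A')%:~R + (B - B')%:~R * eta.
    by rewrite mulrBr zAB zAB' !intrB; ring.
  have lt1 : `|(A - A')%:~R + (B - B')%:~R * eta| < (Num.min 1 (complex.Im eta))%:C%C.
    rewrite -h normrM normr_nat mulrC -ltr_pdivlMr//.
    apply: lt_le_trans zz _; rewrite le_eqVlt; apply/orP; left; apply/eqP.
    by rewrite /e; field; rewrite lt0r_neq0.
  have BB : B - B' = 0.
    have := le_lt_trans (normc_ge_Im _) lt1.
    rewrite -!(rmorph_int (real_complex R)) ltcR lt_min => /andP[_].
    case: (eta) eta_im => u v /= v0; rewrite !mul0r addr0 add0r normrM (gtr0_norm v0).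
    rewrite gtr_pMl// -intr_norm -[1]/(1%:~R) ltr_int => h1.
    by apply/eqP; rewrite -absz_eq0; lia.
  have AA : A - A' = 0.
    move: lt1; rewrite BB mul0r addr0 -intr_norm -(rmorph_int (real_complex R)).
    rewrite ltcR lt_min => /andP[+ _]; rewrite -[1]/(1%:~R) ltr_int => h1.
    by apply/eqP; rewrite -absz_eq0; lia.
  move/eqP: h; rewrite AA BB mul0r addr0 mulr0z mulf_eq0 (negPf (lt0r_neq0 n0)) subr_eq0.
  by move/eqP.
have [[z1 [z1t z1z0 z1e]]|none] := pselect (exists z1, [/\ torsion eta n z1,
    z1 != z0 & `|z0 - z1| < e]).
  have d0 : 0 < `|z0 - z1| by rewrite normr_gt0 subr_eq0 eq_sym.
  have := @nbhsx_ballx _ (C^o) (z0 : C^o) _ d0.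
  apply: filterS => z; rewrite /ball /= => zd; right => zt.
  have zz1 : z = z1.
    apply: near_eq => //; rewrite -[z - z1](subrKA z0) mulr2n mulrDl mul1r.
    apply: le_lt_trans (ler_normD _ _) _; rewrite ltrD// distrC.
    exact: lt_trans zd z1e.
  by rewrite zz1 ltxx in zd.
have := @nbhsx_ballx _ (C^o) (z0 : C^o) _ e0.
apply: filterS => z; rewrite /ball /= => zd.
have [->|zz0] := eqVneq z z0; first by left.
by right => zt; apply: none; exists z.
Qed.

End ThetaZ.

(** * Lines spanned by holomorphic vectors *)

Section Lines.
Context {R : realType}.
Local Notation C := R[i].

Lemma vline_scale (V : vectType C) (c : C) (v : V) : c != 0 -> (<[c *: v]> = <[v]>)%VS.
Proof.
move=> c0; apply: subv_anti; rewrite -!memvE memvZ ?memv_line//=.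
by rewrite -[X in X \in _](scalerK c0) memvZ// memv_line.
Qed.

Lemma vline_scaled (V : vectType C) (u v : V) : (<[u]> = <[v]>)%VS ->
  exists c : C, u = c *: v.
Proof. by move=> e; apply/vlineP; rewrite -e memv_line. Qed.

Lemma holo_sum (I : Type) (s : seq I) (f : I -> C -> C) z :
  (forall i, holo (f i) z) -> holo (fun w => \sum_(i <- s) f i w) z.
Proof.
move=> fh; elim: s => [|i s IH].
  by under [X in holo X]eq_fun do rewrite big_nil; apply: holo_cst.
under [X in holo X]eq_fun do rewrite big_cons.
exact (@holoD R (f i) (fun w => \sum_(j <- s) f j w) z (fh i) IH).
Qed.

Variable d : nat.
Implicit Types g : C -> 'M[C]_d.

Definition holo_frame g z := (forall a b, holo (fun w => g w a b) z) /\ g z != 0.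

(** The 2 x 2 minors of the pair of vectors are continuous and vanish off the
    point, hence also at the point. *)
Lemma line_continuation g g' (z0 : C) :
  holo_frame g z0 -> holo_frame g' z0 ->
  (\forall z \near (z0 : C^o), z != z0 -> (<[g z]> = <[g' z]>)%VS) ->
  (<[g z0]> = <[g' z0]>)%VS.
Proof.
move=> [gh g0] [gh' g0'] gg'.
have minor0 a b a' b' : g z0 a b * g' z0 a' b' = g z0 a' b' * g' z0 a b.
  pose h (z : C) : C := g z a b * g' z a' b' + - g z a' b' * g' z a b.
  have hh : holo h z0.
    have hN : holo (fun w => - g w a' b') z0.
      exact (@derivableN _ _ _ _ _ _ (gh a' b')).
    exact (@holoD R _ _ z0 (@holoM R _ _ z0 (gh a b) (gh' a' b'))
      (@holoM R _ _ z0 hN (gh' a b))).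
  apply/eqP; rewrite -subr_eq0 -mulNr -/(h z0); apply/eqP.
  have hc : (h z : C^o) @[z --> (z0 : C^o)^'] --> (h z0 : C^o).
    by apply: cvg_within_filter; exact: (holo_continuous hh).
  apply: (@cvg_unique (C^o) (@norm_hausdorff _ (C^o)) _ _ _ _ hc).
  apply: cvg_near_cst.
  move: gg'; apply: filterS => z gz zz0.
  have [c gc] := vline_scaled (gz zz0).
  by rewrite /h gc !mxE; ring.
have /matrix0Pn[a' [b' gab']] := g0'.
have gE : g z0 = (g z0 a' b' / g' z0 a' b') *: g' z0.
  apply/matrixP => a b; rewrite mxE mulrAC -minor0 mulfK//.
rewrite gE vline_scale//; apply: contraNneq g0 => c0.
by rewrite gE c0 scale0r.
Qed.

End Lines.

(** * The vectors r_ij and their poles *)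

Section Relations.
Context {R : realType}.
Local Notation C := R[i].
Variables (eta : C) (n k : nat).
Hypothesis eta_im : 0 < complex.Im eta.
Hypothesis n_gt1 : (1 < n)%N.
Local Notation d := (Zp_trunc n).+2.
Implicit Types (i j r a : 'Z_n) (z : C).

Let kZ : 'Z_n := k%:R.

Lemma kZ_unit : coprime n k -> kZ \is a GRing.unit.
Proof. by move=> nk; rewrite unitZpE. Qed.

Definition tensor_family i j (c : 'Z_n -> C) : 'M[C]_d :=
  \sum_r c r *: tens (xgen (j - r)) (xgen (i + r)).

Lemma tens_xgen (a b : 'Z_n) : tens (xgen a) (xgen b) = delta_mx a b :> 'M[C]_d.
Proof. by rewrite /tens /xgen trmx_delta mul_delta_mx. Qed.

Lemma tensor_family_entry i j c r : tensor_family i j c (j - r) (i + r) = c r.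
Proof.
rewrite /tensor_family summxE (bigD1 r)//= tens_xgen !mxE !eqxx mulr1.
rewrite big1 ?addr0// => s sr; rewrite tens_xgen !mxE.
by rewrite (inj_eq (addrI i)) [r == s]eq_sym (negPf sr) andbF mulr0.
Qed.

Lemma tensor_family_neq0 i j c r : c r != 0 -> tensor_family i j c != 0.
Proof.
by apply: contraNneq => c0; rewrite -(tensor_family_entry i j c r) c0 mxE.
Qed.

Lemma holo_tensor_family i j (c : 'Z_n -> C -> C) z :
  (forall r, holo (c r) z) ->
  forall a b, holo (fun w => tensor_family i j (c^~ w) a b) z.
Proof.
move=> ch a b.
rewrite (_ : (fun w => _) = fun w => \sum_(r <- index_enum _)
  c r w * tens (xgen (j - r)) (xgen (i + r)) a b); last first.
  by apply/funext => w; rewrite summxE; apply: eq_bigr => r _; rewrite mxE.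
apply: (@holo_sum R _ _ (fun r w => _)) => r.
exact (@holoM R (c r) (fun=> _) z (ch r) (@holo_cst R _ z)).
Qed.

Definition rnum i j r : C := thetaZ eta (j - i + (kZ - 1) * r) 0.

Definition rcoef i j r z : C :=
  rnum i j r / (thetaZ eta (j - i - r) (- z) * thetaZ eta (kZ * r) z).

Lemma rvecE i j z : rvec k eta i j z = tensor_family i j (rcoef i j ^~ z).
Proof. by []. Qed.

(** The two denominators of index r, both expressed through theta functions at
    z by means of theta_(- a)(- z) = unit * theta_a(z). *)
Definition regular_at i j r z :=
  thetaZ eta (r - (j - i)) z != 0 /\ thetaZ eta (kZ * r) z != 0.

Lemma thetaZ_opp i j r z : thetaZ eta (j - i - r) (- z) =
  - ezp (- (n%:R * z) - (nat_of_ord (r - (j - i)))%:R / n%:R) * thetaZ eta (r - (j - i)) z.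
Proof.
have := thetaZN eta_im n_gt1 (r - (j - i)) z; rewrite opprB => ->.
by [].
Qed.

Lemma rden_neq0 i j r z : regular_at i j r z ->
  thetaZ eta (j - i - r) (- z) * thetaZ eta (kZ * r) z != 0.
Proof.
move=> [h1 h2]; apply: (mulf_neq0 _ h2); rewrite thetaZ_opp.
by apply: (mulf_neq0 _ h1); rewrite oppr_eq0 ezp_neq0.
Qed.

Lemma holo_thetaZ_opp a z : holo (fun w => thetaZ eta a (- w)) z.
Proof.
apply: (@holo_comp R (fun w => - w) (thetaZ eta a)); last exact: holo_thetaZ.
exact (@derivableN _ _ _ _ _ _ (@holo_id R z)).
Qed.

Lemma holo_rcoef i j r z : (rnum i j r != 0 -> regular_at i j r z) ->
  holo (rcoef i j r) z.
Proof.
have [r0 _|r0 /(_ isT) reg] := eqVneq (rnum i j r) 0.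
  rewrite (_ : rcoef i j r = fun=> 0); first exact: holo_cst.
  by apply/funext => w; rewrite /rcoef r0 mul0r.
have hd : holo (fun w => thetaZ eta (j - i - r) (- w) * thetaZ eta (kZ * r) w) z.
  have hk : holo (thetaZ eta (kZ * r)) z by exact: holo_thetaZ.
  exact (@holoM R _ _ z (@holo_thetaZ_opp (j - i - r) z) hk).
exact (@holoM R (fun=> rnum i j r) _ z (@holo_cst R _ z)
  (@holoV R _ z (rden_neq0 reg) hd)).
Qed.

Lemma nontorsion_regular i j r z : ~ torsion eta n z -> regular_at i j r z.
Proof. by move=> zt; split; apply: thetaZ_nontorsion. Qed.

(** The tensors are independent and, off the torsion points, the denominators
    do not vanish; so r_ij vanishes as soon as it vanishes at one such point,
    and then all its numerators are 0. *)
Lemma rvec_nonzeroP i j : ~ rvec_identically_zero k eta i j <-> exists r, rnum i j r != 0.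
Proof.
split=> [nz|[r r0]].
  apply: contrapT => none; apply: nz => z _; rewrite rvecE /tensor_family big1// => r _.
  have [r0|r0] := eqVneq (rnum i j r) 0; last by case: none; exists r.
  by rewrite /rcoef r0 mul0r scale0r.
have [z zt] : exists z, ~ torsion eta n z.
  (* n z = 1/2 is not in Lambda *)
  exists (2 * n%:R)^-1 => -[A [B]].
  have n0 : n%:R != 0 :> C by rewrite pnatr_eq0 -lt0n ltnW.
  rewrite invfM mulrCA mulfV// mulr1 => /(congr1 (fun w => 2 * w)).
  rewrite divff ?pnatr_eq0// mulrDr mulrA => e.
  have := @int_span_inj R eta eta_im 1 0 (2 * A) (2 * B).
  rewrite !intrM mul0r addr0 -e => /(_ erefl)[/eqP + _].
  by rewrite eq_sym; apply/negP; lia.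
move=> /(_ z zt) /eqP; apply/negP; rewrite rvecE.
apply: (@tensor_family_neq0 _ _ _ r); rewrite mulf_neq0// invr_neq0//.
exact/rden_neq0/nontorsion_regular.
Qed.

Lemma rvec_frame i j z : ~ rvec_identically_zero k eta i j ->
  (forall r, rnum i j r != 0 -> regular_at i j r z) ->
  holo_frame (rvec k eta i j) z.
Proof.
move=> /rvec_nonzeroP[r r0] reg; split.
  apply: (@holo_tensor_family i j (rcoef i j)) => s; apply: holo_rcoef; exact: reg.
rewrite rvecE; apply: (@tensor_family_neq0 _ _ _ r).
by rewrite mulf_neq0// invr_neq0// rden_neq0//; apply: reg.
Qed.

(** The coefficient of index r of theta_a * r_ij, with the factor theta_a
    cancelled against the denominator where it occurs there, so that the
    formula still makes sense at a zero of theta_a. *)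
Definition polar_coef i j a r z : C :=
  - rnum i j r * ezp (n%:R * z + (nat_of_ord (r - (j - i)))%:R / n%:R) *
  (if r - (j - i) == a then (thetaZ eta (kZ * r) z)^-1
   else if kZ * r == a then (thetaZ eta (r - (j - i)) z)^-1
   else thetaZ eta a z / (thetaZ eta (r - (j - i)) z * thetaZ eta (kZ * r) z)).

Lemma polar_coefE i j a r z : (forall b, thetaZ eta (b : 'Z_n) z != 0) ->
  polar_coef i j a r z = thetaZ eta a z * rcoef i j r z.
Proof.
move=> th0; rewrite /polar_coef /rcoef thetaZ_opp -opprD ezpN.
have ez := ezp_neq0 (n%:R * z + (nat_of_ord (r - (j - i)))%:R / n%:R).
case: eqP => [<-|_]; first by field; rewrite !th0 ez.
by case: eqP => [<-|_]; field; rewrite !th0 ez.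
Qed.

Lemma holo_polar_coef i j a r z :
  (r - (j - i) != a -> thetaZ eta (r - (j - i)) z != 0) ->
  (kZ * r != a -> thetaZ eta (kZ * r) z != 0) ->
  (r - (j - i) = a -> kZ * r != a) ->
  holo (polar_coef i j a r) z.
Proof.
move=> h1 h2 h12.
have hu : holo (fun z => ezp (n%:R * z + (nat_of_ord (r - (j - i)))%:R / n%:R)) z.
  apply: (@holo_comp R (fun z => _) (@ezp R)); last exact: holo_ezp.
  apply: holoD; last exact: holo_cst.
  by apply: holoM; [exact: holo_cst|exact: holo_id].
have hc := @holoM R (fun=> - rnum i j r) _ z (@holo_cst R _ z) hu.
have ht b : holo (thetaZ eta (b : 'Z_n)) z by exact: holo_thetaZ.
rewrite /polar_coef; case: eqP => [ra|/eqP ra].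
  exact (@holoM R _ _ z hc (@holoV R _ z (h2 (h12 ra)) (ht _))).
case: eqP => [ka|/eqP ka].
  exact (@holoM R _ _ z hc (@holoV R _ z (h1 ra) (ht _))).
have hp := @holoM R _ _ z (ht (r - (j - i))) (ht (kZ * r)).
exact (@holoM R _ _ z hc (@holoM R _ _ z (ht a)
  (@holoV R _ z (mulf_neq0 (h1 ra) (h2 ka)) hp))).
Qed.

Definition polar_vec i j a z : 'M[C]_d := tensor_family i j (polar_coef i j a ^~ z).

Lemma polar_vecE i j a z : (forall b, thetaZ eta (b : 'Z_n) z != 0) ->
  polar_vec i j a z = thetaZ eta a z *: rvec k eta i j z.
Proof.
move=> th0; rewrite rvecE /polar_vec /tensor_family scaler_sumr.
by apply: eq_bigr => r _; rewrite polar_coefE// scalerA.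
Qed.

End Relations.

(** * Extension of the lines to the elliptic curve *)

Section Extension.
Context {R : realType}.
Local Notation C := R[i].
Variables (eta : C) (n k : nat).
Hypothesis eta_im : 0 < complex.Im eta.
Hypothesis n_gt1 : (1 < n)%N.
Hypothesis coprime_nk : coprime n k.
Local Notation d := (Zp_trunc n).+2.
Implicit Types (i j r a : 'Z_n) (z : C).

Let kZ : 'Z_n := k%:R.

(** The coefficient of index a + (j - i) is not 0: its numerator is
    theta_c(0) with c = k (a + (j - i)) - a. *)
Lemma polar_frame i j a z : (forall b, b != a -> thetaZ eta (b : 'Z_n) z != 0) ->
  kZ * (a + (j - i)) != a -> holo_frame (polar_vec eta k i j a) z.
Proof.
move=> th ka; split.
  apply: (@holo_tensor_family R n i j (polar_coef eta k i j a)) => r.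
  apply: holo_polar_coef => //; [exact: th|exact: th|].
  by move=> ra; move: ka; rewrite -{1}ra subrK.
apply: (@tensor_family_neq0 _ _ _ _ _ (a + (j - i))).
rewrite /polar_coef addrK eqxx; apply: mulf_neq0; last first.
  by rewrite invr_neq0// th.
apply: mulf_neq0; last exact: ezp_neq0.
rewrite oppr_eq0; apply: thetaZ0_neq0 => //.
apply: contraNneq ka => h; rewrite -subr_eq0 -[X in _ == X]h; apply/eqP.
by rewrite -/kZ; ring.
Qed.

(** Both denominators of index r = a + (j - i), and of no other index, may
    vanish, but the numerator of this index is theta_0(0) = 0. *)
Lemma regular_off_pole i j a z : (forall b, b != a -> thetaZ eta (b : 'Z_n) z != 0) ->
  kZ * (a + (j - i)) = a ->
  forall r, rnum eta k i j r != 0 -> regular_at eta k i j r z.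
Proof.
move=> th ka r r0.
have ra : r - (j - i) != a.
  apply: contraNneq r0 => ra; rewrite /rnum.
  have -> : j - i + (k%:R - 1) * r = 0; last by rewrite thetaZ00.
  have -> : r = a + (j - i) by rewrite -ra subrK.
  by rewrite mulrBl ka mul1r; ring.
split; apply: th => //; apply: contraNneq ra => kra.
rewrite -[X in _ == X]ka -(addrK (j - i) a).
have -> : r = a + (j - i); last by rewrite addrK ka.
by apply: (mulrI (kZ_unit n_gt1 coprime_nk)); rewrite ka.
Qed.

Lemma theta_near_torsion (z0 : C) (A B : int) : n%:R * z0 = A%:~R + B%:~R * eta ->
  \forall z \near (z0 : C^o), forall b, b != - B%:~R -> thetaZ eta (b : 'Z_n) z != 0.
Proof.
move=> AB; apply: filterS (torsion_isolated eta_im n_gt1 z0) => z [->|zt] b bB.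
  exact: (thetaZ_zero eta_im n_gt1 AB).
exact: thetaZ_nontorsion.
Qed.

Lemma polar_vec_near i j (z0 : C) (A B : int) :
  n%:R * z0 = A%:~R + B%:~R * eta -> kZ * (- B%:~R + (j - i)) != - B%:~R ->
  \forall z \near (z0 : C^o), holo_frame (polar_vec eta k i j (- B%:~R)) z /\
    (~ torsion eta n z ->
       <[polar_vec eta k i j (- B%:~R) z]> = <[rvec k eta i j z]>)%VS.
Proof.
move=> /theta_near_torsion zP ka; apply: filterS zP => z th.
split; first exact: polar_frame.
move=> zt; rewrite polar_vecE//; last by move=> b; apply: thetaZ_nontorsion.
by rewrite vline_scale//; apply: thetaZ_nontorsion.
Qed.

Lemma rvec_near i j (z0 : C) (A B : int) : ~ rvec_identically_zero k eta i j ->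
  n%:R * z0 = A%:~R + B%:~R * eta -> kZ * (- B%:~R + (j - i)) = - B%:~R ->
  \forall z \near (z0 : C^o), holo_frame (rvec k eta i j) z.
Proof.
move=> nz /theta_near_torsion zP ka; apply: filterS zP => z th.
by apply: rvec_frame => //; apply: (regular_off_pole th ka).
Qed.

Lemma local_section i j z0 : ~ rvec_identically_zero k eta i j ->
  exists g, \forall z \near (z0 : C^o), holo_frame g z /\
    (~ torsion eta n z -> <[g z]> = <[rvec k eta i j z]>)%VS.
Proof.
move=> nz; have [[A [B AB]]|z0t] := pselect (torsion eta n z0); last first.
  exists (rvec k eta i j); apply: filterS (torsion_isolated eta_im n_gt1 z0) => z zz.
  have zt : ~ torsion eta n z by case: zz => [->|].
  by split=> //; apply: rvec_frame => // r _; apply: nontorsion_regular.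
have [ka|ka] := eqVneq (kZ * (- B%:~R + (j - i))) (- B%:~R).
  by exists (rvec k eta i j); apply: filterS (rvec_near nz AB ka) => z.
by exists (polar_vec eta k i j (- B%:~R)); apply: (polar_vec_near AB).
Qed.

(** Torsion points are isolated, so lines that agree elsewhere agree at them by
    continuity. *)
Lemma morphism_continuation (L L' : C -> {vspace 'M[C]_d}) z0 :
  (exists g, \forall z \near (z0 : C^o), holo_frame g z /\ L z = <[g z]>%VS) ->
  (exists g, \forall z \near (z0 : C^o), holo_frame g z /\ L' z = <[g z]>%VS) ->
  (forall z, ~ torsion eta n z -> L z = L' z) -> L z0 = L' z0.
Proof.
move=> [g gL] [g' gL'] LL'.
have [fr ->] := nbhs_singleton gL; have [fr' ->] := nbhs_singleton gL'.
apply: line_continuation => //.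
near=> z => zz0.
have [_ <-] : holo_frame g z /\ L z = <[g z]>%VS by near: z.
have [_ <-] : holo_frame g' z /\ L' z = <[g' z]>%VS by near: z.
apply: LL'.
have : z = z0 \/ ~ torsion eta n z by near: z; apply: torsion_isolated.
by case=> // e; rewrite e eqxx in zz0.
Unshelve. all: by end_near. Qed.

Lemma proj_morphism_frame (L : C -> {vspace 'M[C]_d}) : proj_morphism eta L ->
  forall z0, exists g, \forall z \near (z0 : C^o), holo_frame g z /\ L z = <[g z]>%VS.
Proof.
move=> [_ h] z0; have [g gh] := h z0; exists g.
by apply: filterS gh => z [].
Qed.

Lemma rvecD1 i j z : rvec k eta i j (z + 1) = rvec k eta i j z.
Proof.
rewrite /rvec; apply: eq_bigr => r _; congr (_ / (_ * _) *: _).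
  by rewrite -[in LHS](thetaZD1 eta_im); congr thetaZ; ring.
exact: thetaZD1.
Qed.

Lemma rvecDeta i j z : exists2 c : C, c != 0 &
  rvec k eta i j (z + eta) = c *: rvec k eta i j z.
Proof.
exists (ezp (- (n%:R * (- z - eta))) / ezp (- (n%:R * z))).
  by apply: mulf_neq0; rewrite ?invr_neq0 ?ezp_neq0.
rewrite /rvec scaler_sumr; apply: eq_bigr => r _; rewrite scalerA; congr (_ *: _).
rewrite (thetaZDeta eta_im n_gt1).
have -> : thetaZ eta (j - i - r) (- z) =
   - ezp (- (n%:R * (- z - eta))) * thetaZ eta (j - i - r) (- (z + eta)).
  have := thetaZDeta eta_im n_gt1 (j - i - r) (- z - eta).
  by rewrite subrK opprD.
have e1 := ezp_neq0 (- (n%:R * (- z - eta))).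
have e2 := ezp_neq0 (- (n%:R * z)).
move: (ezp _) (ezp _) e1 e2 (thetaZ _ _ (- (z + eta))) (thetaZ _ _ z) (thetaZ _ _ 0).
move=> u v u0 v0 s t w; rewrite !invfM !invrN.
by move: (s^-1) (t^-1) => s' t'; field; rewrite u0 v0.
Qed.

(** The translate by l is again a family of lines with local frames, and it
    agrees with L off the torsion points. *)
Lemma extension_period (L : C -> {vspace 'M[C]_d}) (l : C) :
  (forall z0, exists g, \forall z \near (z0 : C^o),
     holo_frame g z /\ L z = <[g z]>%VS) ->
  (forall z, ~ torsion eta n z -> L (z + l) = L z) ->
  forall z, L (z + l) = L z.
Proof.
move=> Lf Ll z0.
apply: (@morphism_continuation (fun z => L (z + l)) L) => //.
have [g gL] := Lf (z0 + l).
exists (fun w => g (w + l)).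
have hl z : holo (fun w => w + l) z.
  by apply: holoD; [exact: holo_id|exact: holo_cst].
have cl : (w + l : C^o) @[w --> (z0 : C^o)] --> (z0 + l : C^o).
  exact: (holo_continuous (hl z0)).
have gl : \forall w \near (z0 : C^o),
  holo_frame g (w + l) /\ L (w + l) = <[g (w + l)%R]>%VS.
  exact (cl _ gL).
apply: filterS gl => z [[gh g0] Lz].
split; last exact Lz.
split; last exact g0.
move=> a b.
apply: (@holo_comp R (fun w => w + l) (fun w => g w a b)); last exact: gh.
exact: hl.
Qed.

(** At each point take the value there of a local frame around it; all these
    frames span the line of r_ij off the torsion points, so near z0 the lines
    are spanned by the frame chosen at z0. *)
Lemma extension_exists i j : ~ rvec_identically_zero k eta i j ->
  exists L, extends_rvec k eta i j L.
Proof.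
move=> nz; have /choice[g gP] := fun z0 => @local_section i j z0 nz.
pose L z := <[g z z]>%VS.
have Lr z : ~ torsion eta n z -> L z = <[rvec k eta i j z]>%VS.
  by move=> zt; rewrite /L; have [_ ->] := nbhs_singleton (gP z).
have Lf z0 : exists g, \forall z \near (z0 : C^o), holo_frame g z /\ L z = <[g z]>%VS.
  exists (g z0); near=> z.
  have [fr gr] : holo_frame (g z0) z /\
      (~ torsion eta n z -> <[g z0 z]> = <[rvec k eta i j z]>)%VS.
    by near: z; exact: gP.
  split=> //; have : z = z0 \/ ~ torsion eta n z by near: z; apply: torsion_isolated.
  by move=> [-> //|zt]; rewrite Lr// gr.
have L1 : forall z, L (z + 1) = L z.
  apply: extension_period => // z zt; rewrite !Lr// ?rvecD1//.
  apply: contra_not zt => -[A [B AB]]; exists (A - n%:Z), B.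
  rewrite intrB -pmulrn addrAC -AB mulrDr mulr1 addrK.
  by [].
have Leta : forall z, L (z + eta) = L z.
  apply: extension_period => // z zt; rewrite !Lr//.
    by have [c c0 ->] := rvecDeta i j z; rewrite vline_scale.
  apply: contra_not zt => -[A [B AB]]; exists A, (B - n%:Z).
  by rewrite intrB -pmulrn mulrBl addrA -AB mulrDr addrK.
have iterl (l : C) : (forall z, L (z + l) = L z) ->
    forall (A : int) z, L (z + A%:~R * l) = L z.
  move=> Ll A z; have h (m : nat) w : L (w + m%:R * l) = L w.
    elim: m w => [|m IH] w; first by rewrite mul0r addr0.
    by rewrite -natr1 mulrDl mul1r addrA Ll.
  case: A => m; first exact: h.
  by rewrite NegzE mulrNz mulNr -(h m.+1) subrK.
exists L; split=> //; split; last first.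
  move=> z0; have [f fP] := Lf z0; exists f.
  by apply: filterS fP => z [[fh f0] ->]; split.
move=> z l [A [B ->]]; rewrite addrA iterl//.
by rewrite -[A%:~R]mulr1 iterl.
Unshelve. all: by end_near. Qed.

Lemma Lline_extends i j : ~ rvec_identically_zero k eta i j ->
  extends_rvec k eta i j (Lline k eta i j).
Proof. by move=> /extension_exists[L LP]; apply: (xgetPex _ (ex_intro _ L LP)). Qed.

(** Any frame around 0 that spans the line of r_ij off the torsion points
    computes the extension at 0. *)
Lemma Lline_frame i j g : ~ rvec_identically_zero k eta i j ->
  (\forall z \near (0 : C^o), holo_frame g z /\
    (~ torsion eta n z -> <[g z]> = <[rvec k eta i j z]>)%VS) ->
  Lline k eta i j 0 = <[g 0%R]>%VS.
Proof.
move=> nz gP; have [Lm Lr] := Lline_extends nz.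
have [f fP] := proj_morphism_frame Lm 0.
have [ff ->] := nbhs_singleton fP; have [gf _] := nbhs_singleton gP.
apply: line_continuation => //; near=> z => z0.
have zt : ~ torsion eta n z.
  have : z = 0 \/ ~ torsion eta n z by near: z; apply: torsion_isolated.
  by case=> // e; rewrite e eqxx in z0.
have [_ <-] : holo_frame f z /\ Lline k eta i j z = <[f z]>%VS by near: z.
rewrite Lr//; apply/esym.
have [_ ->//] : holo_frame g z /\
    (~ torsion eta n z -> <[g z]> = <[rvec k eta i j z]>)%VS by near: z.
Unshelve. all: by end_near. Qed.

End Extension.

(** * The lines at the origin *)

(** For even n the index n / 2 is its own mirror image, which is why the term
    there has to vanish. *)
Lemma big_nat_symm (V : zmodType) (n : nat) (F : nat -> V) : (0 < n)%N ->
  F 0%N = 0 -> (~~ odd n -> F n./2 = 0) ->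
  \sum_(0 <= r < n) F r = \sum_(1 <= r < uphalf n) (F r + F (n - r)%N).
Proof.
move=> n0 F0 Fhalf; have ne := odd_double_half n; have ue := uphalf_half n.
rewrite big_ltn// F0 add0r big_split /=.
rewrite (@big_cat_nat _ _ _ (uphalf n))/=; [|by move: n0 ne; rewrite ue; case: (odd n); lia|lia].
congr (_ + _).
have -> : \sum_(1 <= r < uphalf n) F (n - r)%N = \sum_(1 + (n - uphalf n) <= r < n) F r.
  rewrite [LHS]big_nat_rev big_addn /=.
  have -> : (n - (n - uphalf n) = uphalf n)%N by lia.
  by rewrite !big_nat; apply: eq_bigr => r rn; congr F; lia.
case: (boolP (odd n)) => nodd; move: ne ue; rewrite ?nodd ?(negPf nodd) => ne ue.
  by congr (\sum_(_ <= r < _) _); lia.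
rewrite big_ltn; last by lia.
rewrite ue add0n Fhalf// add0r.
by congr (\sum_(_ <= r < _) _); lia.
Qed.

Section AtOrigin.
Context {R : realType}.
Local Notation C := R[i].
Variables (eta : C) (n k : nat).
Hypothesis eta_im : 0 < complex.Im eta.
Hypothesis n_gt1 : (1 < n)%N.
Hypothesis coprime_nk : coprime n k.
Local Notation d := (Zp_trunc n).+2.
Implicit Types (i j r a : 'Z_n) (z : C).

Let kZ : 'Z_n := k%:R.

Let origin : n%:R * 0 = 0%:~R + 0%:~R * eta :> C.
Proof. by rewrite mulr0 mul0r addr0. Qed.

Lemma rvec_neq_not_identically_zero i j : i != j ->
  ~ rvec_identically_zero k eta i j.
Proof.
move=> ij; apply/rvec_nonzeroP => //; exists 0.
by rewrite /rnum mulr0 addr0 thetaZ0_neq0// subr_eq0 eq_sym.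
Qed.

(** The coefficients of theta_0 r_ij at 0 vanish with theta_0(0), except for
    the two poles r = 0 and r = j - i. *)
Lemma Lline_off_diagonal i j : i != j -> Lline k eta i j 0 = <[bracket i j]>%VS.
Proof.
move=> ij; have ji : j - i != 0 by rewrite subr_eq0 eq_sym.
have kji : kZ * (- 0%:~R + (j - i)) != - 0%:~R.
  rewrite oppr0 add0r mulrI_eq0//; exact: mulrI (kZ_unit n_gt1 coprime_nk).
rewrite (Lline_frame eta_im n_gt1 coprime_nk (rvec_neq_not_identically_zero ij)
  (polar_vec_near eta_im n_gt1 origin kji)).
rewrite oppr0.
suff -> : polar_vec eta k i j 0 0 = - bracket i j.
  by rewrite -scaleN1r vline_scale// oppr_eq0 oner_eq0.
have c0 : polar_coef eta k i j 0 0 0 = 1.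
  rewrite /polar_coef sub0r oppr_eq0 (negPf ji) !mulr0 eqxx /rnum !mulr0 addr0 add0r.
  have := thetaZN0 eta_im n_gt1 (- (j - i)); rewrite opprK ezpN => ->.
  have := thetaZ0_neq0 eta_im n_gt1 (a := - (j - i)); rewrite oppr_eq0 => /(_ ji) th0.
  have := ezp_neq0 ((nat_of_ord (- (j - i)))%:R / n%:R : C).
  move: (ezp _) th0; move: (thetaZ _ _ _) => t u t0 u0; field.
  by rewrite t0 u0.
have c1 : polar_coef eta k i j 0 (j - i) 0 = -1.
  rewrite /polar_coef subrr eqxx /rnum mulr0 mul0r addr0 ezp0 mulr1.
  have -> : j - i + (k%:R - 1) * (j - i) = kZ * (j - i) by rewrite /kZ; ring.
  rewrite mulNr mulfV//.
  apply: thetaZ0_neq0 => //.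
  by move: kji; rewrite oppr0 add0r.
rewrite /polar_vec /tensor_family (bigD1 0)//= (bigD1 (j - i))//= big1 => [|r /andP[r0 rji]].
  rewrite c0 c1 scale1r scaleN1r subr0 !addr0 subKr [i + (j - i)]addrC subrK.
  by rewrite /bracket opprB.
rewrite /polar_coef subr_eq0 (negPf rji) mulrI_eq0 ?(negPf r0).
  by rewrite (thetaZ00 eta_im n_gt1) mul0r mulr0 scale0r.
exact: mulrI (kZ_unit n_gt1 coprime_nk).
Qed.

Definition diag_coef r : C :=
  thetaZ eta ((kZ - 1) * r) 0 / (thetaZ eta (- r) 0 * thetaZ eta (kZ * r) 0).

(** The root of unity, up to sign, by which theta_a(0) changes when a is replaced
    by - a. *)
Definition chi a : C := ezp (- ((a : nat)%:R / n%:R)).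

Lemma chiD a b : chi (a + b) = chi a * chi b.
Proof.
have n0 : n%:R != 0 :> C by rewrite pnatr_eq0 -lt0n ltnW.
have eq1 (m : nat) : ezp (- m%:R) = 1 :> C.
  by rewrite ezpN [ezp _](ezp_int m) invr1.
rewrite /chi -ezpD -opprD -mulrDl -natrD.
have -> : nat_of_ord (a + b) = ((nat_of_ord a + nat_of_ord b) %% n)%N.
  by rewrite [LHS]/=; congr (_ %% _)%N; apply: Zp_cast.
rewrite [in RHS](divn_eq (nat_of_ord a + nat_of_ord b) n) natrD natrM mulrDl mulfK// opprD ezpD.
by rewrite eq1 mul1r.
Qed.

Lemma chi_neq0 a : chi a != 0. Proof. exact: ezp_neq0. Qed.

Lemma thetaZN0_chi a : thetaZ eta (- a) 0 = - chi a * thetaZ eta a 0.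
Proof. exact: thetaZN0. Qed.

(** The three roots of unity cancel because (k - 1) r = - r + k r, and three
    signs are left. *)
Lemma diag_coefN r : diag_coef (- r) = - diag_coef r.
Proof.
rewrite /diag_coef (thetaZN0_chi (- r)) !mulrN (thetaZN0_chi ((kZ - 1) * r)) (thetaZN0_chi (kZ * r)).
have -> : chi ((kZ - 1) * r) = chi (- r) * chi (kZ * r).
  by rewrite -chiD; congr chi; ring.
move: (chi _) (chi _) (chi_neq0 (- r)) (chi_neq0 (kZ * r)) => u v u0 v0.
move: (thetaZ eta ((kZ - 1) * r) 0) (thetaZ eta (- r) 0) (thetaZ eta (kZ * r) 0) => x y z.
rewrite !invfM !invrN; move: (y^-1) (z^-1) => y' z'; field.
by rewrite u0 v0.
Qed.

Lemma rvec_diag0 i : rvec k eta i i 0 =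
  \sum_(1 <= r < uphalf n) diag_coef r%:R *: bracket (i - r%:R) (i + r%:R).
Proof.
pose F (r : nat) : 'M[C]_d :=
  diag_coef r%:R *: tens (xgen (i - r%:R)) (xgen (i + r%:R)).
have -> : rvec k eta i i 0 = \sum_(0 <= r < n) F r.
  transitivity (\sum_(0 <= r < d) F r); last first.
    by congr (\sum_(0 <= r < _) _); apply: Zp_cast.
  rewrite big_mkord; apply: eq_bigr => r _.
  rewrite /F /diag_coef natr_Zp subrr oppr0 !sub0r add0r.
  by [].
have c0 : diag_coef 0 = 0 by rewrite /diag_coef mulr0 (thetaZ00 eta_im n_gt1) mul0r.
have nN (r : nat) : (r <= n)%N -> (n - r)%:R = - r%:R :> 'Z_n.
  by move=> rn; rewrite natrB// pchar_Zp// sub0r.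
rewrite (big_nat_symm (F := F)); last 3 first.
- exact: ltnW.
- by rewrite /F c0 scale0r.
- move=> nodd; have e := odd_double_half n; rewrite (negPf nodd) add0n in e.
  have : diag_coef (n./2)%:R = - diag_coef (n./2)%:R.
    rewrite -diag_coefN -nN; last by lia.
    by congr (diag_coef _%:R); lia.
  by move=> /eqP; rewrite eq_sym eqNr /F => /eqP ->; rewrite scale0r.
rewrite !big_nat; apply: eq_bigr => r /andP[r1 r2].
have rn : (r <= n)%N by move: r2; rewrite uphalfE; lia.
rewrite /F nN// diag_coefN opprK scaleNr -scalerBr.
by [].
Qed.

Lemma Lline_diagonal i : ~ rvec_identically_zero k eta i i ->
  Lline k eta i i 0 =
  <[\sum_(1 <= r < uphalf n) diag_coef r%:R *: bracket (i - r%:R) (i + r%:R)]>%VS.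
Proof.
move=> nz; rewrite -rvec_diag0.
apply: (Lline_frame eta_im n_gt1 coprime_nk nz).
have k0 : kZ * (- 0%:~R + (i - i)) = - 0%:~R by rewrite oppr0 add0r subrr mulr0.
by apply: filterS (rvec_near eta_im n_gt1 coprime_nk nz origin k0) => z.
Qed.

Lemma diag_coefE (r : nat) : diag_coef r%:R =
  theta_ eta n ((k%:Z - 1) * r%:Z) 0
    / (theta_ eta n (- r%:Z) 0 * theta_ eta n (k%:Z * r%:Z) 0).
Proof.
rewrite /diag_coef !(thetaZ_intr eta_im n_gt1).
by rewrite !(intrM, intrB, mulrNz) -!pmulrn.
Qed.

End AtOrigin.

(** * The polynomial ring as a quotient of the tensor algebra *)

Section Ideals.
Variables (A : pzRingType) (I : set A).
Hypothesis I_ideal : two_sided_ideal I.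

Lemma idealD s t : I s -> I t -> I (s + t).
Proof.
have [I0 IB _] := I_ideal => Is It.
by rewrite -[t]opprK; apply: (IB) => //; rewrite -sub0r; apply: (IB).
Qed.

Lemma ideal_add2 s s' t t' : I (s - s') -> I (t - t') -> I (s + t - (s' + t')).
Proof. by move=> Is It; rewrite opprD addrACA; apply: idealD. Qed.

Lemma ideal_mul2l x u v : I (u - v) -> I (x * u - x * v).
Proof. by have [_ _ IM] := I_ideal => /(IM x)[+ _]; rewrite mulrBr. Qed.

Lemma ideal_swap x y w : I (x * y - y * x) -> I (x * (y * w) - y * (x * w)).
Proof. by have [_ _ IM] := I_ideal => /(IM w)[_]; rewrite mulrBl -!mulrA. Qed.

End Ideals.

Lemma bilinear_delta (K : nzRingType) (A : lalgType K) (m : nat) (x : 'I_m -> A)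
    (a b : 'I_m) :
  \sum_u \sum_v (delta_mx a b - delta_mx b a : 'M[K]_m) u v *: (x u * x v) =
  x a * x b - x b * x a.
Proof.
have delta (s t : 'I_m) :
    \sum_u \sum_v (delta_mx s t : 'M[K]_m) u v *: (x u * x v) = x s * x t.
  rewrite (bigD1 s)//= (bigD1 t)//= mxE !eqxx scale1r.
  rewrite big1 ?addr0 => [|v vt]; last by rewrite mxE eqxx (negPf vt) scale0r.
  rewrite big1 ?addr0// => u us; apply: big1 => v _.
  by rewrite mxE (negPf us) scale0r.
rewrite -!delta -sumrB; apply: eq_bigr => u _; rewrite -sumrB.
by apply: eq_bigr => v _; rewrite !mxE scalerBl.
Qed.

(** Exchanging the two indices shows that the sum is its own opposite. *)
Lemma antisymmetric_form0 (K : numFieldType) (A : lalgType K) (m : nat)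
    (M : 'M[K]_m) (x : 'I_m -> A) :
  M^T = - M -> (forall u v, x u * x v = x v * x u) ->
  \sum_u \sum_v M u v *: (x u * x v) = 0.
Proof.
move=> Manti xC; set S := LHS; have S_opp : S = - S.
  rewrite {1}/S exchange_big -sumrN; apply: eq_bigr => u _.
  rewrite -sumrN; apply: eq_bigr => v _.
  by rewrite -scaleNr xC; have /matrixP/(_ u v) := Manti; rewrite !mxE => ->.
move/eqP: S_opp; rewrite -addr_eq0 -mulr2n -scaler_nat scaler_eq0 pnatr_eq0 /=.
by move/eqP.
Qed.

Lemma kernel_ideal (A B : pzRingType) (f : A -> B) : monoid_morphism f ->
  (forall s t, f (s - t) = f s - f t) -> two_sided_ideal [set t | f t = 0].
Proof.
move=> [_ fM] fB; split=> [|s t /= s0 t0|u s /= s0] /=.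
- by rewrite -(subrr (0 : A)) fB subrr.
- by rewrite fB s0 t0 subrr.
- by rewrite !fM s0 mulr0 mul0r.
Qed.

Section Presentation.
Import -(notations) monalg.
Import -(notations) mpoly.
Context {R : realType} {n : nat}.
Local Notation C := R[i].
Local Notation d := (Zp_trunc n).+2.
Local Notation TVn := (@TV R n).
Local Notation pr := (@TV_to_poly R n).

Definition word (w : seq 'Z_n) : TVn := mkmalgU (FMonom w) (1 : C).

Lemma wordM (u v : seq 'Z_n) : word (u ++ v) = word u * word v.
Proof.
rewrite /word; apply/esym; have := @fgmulUU _ C 1 1 (FMonom u) (FMonom v).
rewrite mulr1 => h; rewrite [LHS]h; congr mkmalgU.
by apply/eqP; rewrite -val_eqE /= fmM.
Qed.

Lemma word0 : word [::] = 1.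
Proof.
rewrite /word; congr mkmalgU; apply/eqP; rewrite -val_eqE /=.
by rewrite fm1.
Qed.

Lemma xgenT_word (a : 'Z_n) : xgenT a = word [:: a].
Proof. by rewrite /xgenT fmuE. Qed.

Lemma word_cons (a : 'Z_n) (w : seq 'Z_n) : word (a :: w) = xgenT a * word w.
Proof. by rewrite xgenT_word -wordM. Qed.

(** Words span the tensor algebra. *)
Lemma word_ind (P : TVn -> Prop) : P 0 -> (forall s t, P s -> P t -> P (s + t)) ->
  (forall (c : C) w, P (c *: word w)) -> forall t, P t.
Proof.
move=> P0 PD Pw t; rewrite (monalgE t); apply: big_ind => // m _.
rewrite (_ : mkmalgU m _ = monalg.mcoeff m t *: word (fmonom_val m)) //.
apply/malgP => m'.
by rewrite monalg.mcoeffZ /word !monalg.mcoeffU fmK mulrnAr mulr1.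
Qed.

Definition word_monomial (m : fmonom 'Z_n) : poly_ring :=
  \prod_(a <- fmonom_val m) mpolyX C (mnm1 a).

Lemma word_monomial_mmorphism : mmorphism word_monomial.
Proof.
split=> [u v|]; rewrite /word_monomial.
  by rewrite fmM big_cat.
by rewrite fm1 big_nil.
Qed.

HB.instance Definition _ :=
  monalg.isMultiplicative.Build (fmonom 'Z_n) poly_ring word_monomial
    word_monomial_mmorphism.

Lemma TV_to_polyE t : pr t = monalg.mmap (mpolyC d (R := C)) word_monomial t.
Proof. by []. Qed.

Lemma TV_to_polyD s t : pr (s + t) = pr s + pr t.
Proof. exact: monalg.mmapD. Qed.

Lemma TV_to_polyZ (c : C) t : pr (c *: t) = c *: pr t.
Proof.
rewrite !TV_to_polyE. rewrite (@monalg.mmapZ _ _ _ (mpolyC d (R := C)) word_monomial).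
exact: mul_mpolyC.
Qed.

Lemma TV_to_poly_morphism : monoid_morphism pr.
Proof.
split; first exact: (@monalg.mmap1 _ _ _ (mpolyC d (R := C)) word_monomial).
exact: (rmorphM (monalg.mmap (mpolyC d (R := C)) word_monomial)).
Qed.

Lemma TV_to_poly_word w : pr (word w) = \prod_(a <- w) mpolyX C (mnm1 a).
Proof.
rewrite TV_to_polyE /word.
rewrite (@monalg.mmapU _ _ _ (mpolyC d (R := C)) word_monomial).
transitivity ((1 : poly_ring) * word_monomial (FMonom w)); last by rewrite mul1r.
congr (_ * _); exact: (rmorph1 (mpolyC d (R := C))).
Qed.


Lemma ideal_gen_ideal (A : pzRingType) (S : set A) : two_sided_ideal (ideal_gen S).
Proof.
split=> [J [[J0 _ _] _]|s t Is It J [JI SJ]|a s Is] //.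
  have [_ JB _] := JI; apply: JB; [exact: (Is J)|exact: (It J)].
split=> J [JI SJ]; have [_ _ JM] := JI.
  by have [] := JM a s (Is J (conj JI SJ)).
by have [] := JM a s (Is J (conj JI SJ)).
Qed.

Lemma sub_ideal_gen (A : pzRingType) (S : set A) s : S s -> ideal_gen S s.
Proof. by move=> Ss J [_]; apply. Qed.

(** The linear section of the projection to polynomials that writes the letters
    of each monomial in increasing order. *)
Definition sorted_lift (P : poly_ring) : TVn :=
  mpoly.mmap (GRing.in_alg TVn) (@xgenT R n) P.

Lemma sorted_liftD P Q : sorted_lift (P + Q) = sorted_lift P + sorted_lift Q.
Proof. exact: mpoly.mmapD. Qed.

Lemma sorted_liftZ c P : sorted_lift (c *: P) = c *: sorted_lift P.
Proof.
rewrite /sorted_lift mpoly.mmapZ.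
by rewrite /= -scalerAl mul1r.
Qed.

Lemma word_nseq (a : 'Z_n) m : xgenT a ^+ m = word (nseq m a).
Proof.
elim: m => [|m IH]; first by rewrite word0.
by rewrite exprS IH -word_cons.
Qed.

Lemma sorted_lift_word w : exists2 w', perm_eq w w' &
  sorted_lift (pr (word w)) = word w'.
Proof.
rewrite TV_to_poly_word mprodXE /sorted_lift mpoly.mmapX.
set m : multinom d := bigop.body _ _ _.
have mE (i : 'Z_n) : m i = count_mem i w.
  rewrite /m mnm_sumE -sum1_count [RHS]big_mkcond; apply: eq_bigr => a _.
  by rewrite mnm1E /=; case: (a == i).
rewrite /mpoly.mmap1.
exists (flatten [seq nseq (m i) i | i <- index_enum 'Z_n]).
  apply/allP => a _ /=; apply/eqP.
  rewrite count_flatten -map_comp sumnE big_map.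
  rewrite (bigD1_seq a) ?mem_index_enum ?index_enum_uniq//= count_nseq /= eqxx mul1n mE.
  rewrite big1 ?addn0// => i ia; rewrite count_nseq /=.
  by rewrite (negPf ia).
rewrite (eq_bigr (fun i : 'Z_n => word (nseq (m i) i))); last first.
  by move=> i _; apply: word_nseq.
elim: (index_enum _) => [|i s IH]; first by rewrite big_nil word0.
by rewrite big_cons IH -wordM.
Qed.

Section Kernel.
Variable I : set TVn.
Hypothesis I_ideal : two_sided_ideal I.
Hypothesis I_comm : forall a b : 'Z_n, I (xgenT a * xgenT b - xgenT b * xgenT a).

Lemma idealZ c s : I s -> I (c *: s).
Proof.
have [_ _ IM] := I_ideal => Is.
by have [+ _] := IM (c *: 1) s Is; rewrite -scalerAl mul1r.
Qed.

(** Neighbouring letters commute modulo I, so a letter can be moved to the front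
    of a word. *)
Lemma word_perm w w' : perm_eq w w' -> I (word w - word w').
Proof.
have [I0 IB IM] := I_ideal.
have trans u v t : I (u - v) -> I (v - t) -> I (u - t).
  by move=> uv vt; rewrite -(subrKA v); apply: (idealD I_ideal).
have move_front a v1 v2 : I (word (a :: v1 ++ v2) - word (v1 ++ a :: v2)).
  elim: v1 => [|b v1 IH] /=; first by rewrite subrr.
  apply: (trans _ (word (b :: a :: v1 ++ v2))).
    rewrite !word_cons.
    exact: (ideal_swap I_ideal (word (v1 ++ v2)) (I_comm a b)).
  rewrite (word_cons b (a :: v1 ++ v2)) (word_cons b (v1 ++ a :: v2)).
  exact: (ideal_mul2l I_ideal (xgenT b) IH).
elim: w w' => [|a w IH] w' ww'.
  by rewrite perm_sym in ww'; rewrite (perm_nilP ww') subrr.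
have aw' : a \in w' by rewrite -(perm_mem ww') mem_head.
have [v1 [v2 w'E]] : exists v1 v2, w' = v1 ++ a :: v2.
  by have [v1 v2] := splitPr aw'; exists v1, v2.
apply: (trans _ (word (a :: v1 ++ v2))); last by rewrite w'E; apply: move_front.
rewrite (word_cons a w) (word_cons a (v1 ++ v2)).
have /IH Iw : perm_eq w (v1 ++ v2).
  by move: ww'; rewrite w'E perm_sym -(cat1s a v2) perm_catCA perm_sym perm_cons.
exact: (ideal_mul2l I_ideal (xgenT a) Iw).
Qed.

Lemma sorted_lift_congr t : I (t - sorted_lift (pr t)).
Proof.
have [I0 _ _] := I_ideal.
have lift0 : sorted_lift (pr 0) = 0.
  by rewrite -[0 in LHS](scale0r (1 : TVn)) TV_to_polyZ scale0r -(scale0r (1 : poly_ring)) sorted_liftZ scale0r.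
elim/word_ind: t => [|s t Is It|c w].
- by rewrite lift0 subrr.
- rewrite TV_to_polyD.
  rewrite sorted_liftD.
  exact (ideal_add2 I_ideal Is It).
rewrite TV_to_polyZ sorted_liftZ -scalerBr; apply: idealZ.
by have [w' /word_perm ? ->] := sorted_lift_word w.
Qed.

Lemma TV_to_poly_kernel t : pr t = 0 -> I t.
Proof.
move=> t0; have := sorted_lift_congr t; rewrite t0.
rewrite -(scale0r (1 : poly_ring)) sorted_liftZ scale0r subr0.
by [].
Qed.

End Kernel.

Lemma TV_to_poly_xgen (a : 'Z_n) : pr (xgenT a) = mpolyX C (mnm1 a).
Proof. by rewrite xgenT_word TV_to_poly_word big_seq1. Qed.

Lemma TV_to_poly0 : pr 0 = 0.
Proof. by rewrite -(scale0r (1 : TVn)) TV_to_polyZ scale0r. Qed.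

Lemma TV_to_poly_surj P : exists t, pr t = P.
Proof.
have [pr1 prM] := TV_to_poly_morphism.
elim/mpolyind: P => [|c m P _ _ [t <-]]; first by exists 0; apply: TV_to_poly0.
exists (c *: (\prod_(i < d) xgenT i ^+ m i) + t).
rewrite TV_to_polyD TV_to_polyZ; congr (_ *: _ + _).
rewrite mpolyXE_id (big_morph pr prM pr1); apply: eq_bigr => i _.
elim: (m i) => [|e IH]; first by rewrite expr0.
by rewrite !exprS prM TV_to_poly_xgen IH.
Qed.

Lemma tens2_TV_bracket (a b : 'Z_n) :
  tens2_TV (bracket a b) = xgenT a * xgenT b - xgenT b * xgenT a :> TVn.
Proof. by rewrite /bracket !tens_xgen; exact (bilinear_delta (@xgenT R n) a b). Qed.

(** U consists of antisymmetric tensors and contains the commutators, so it is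
    the space of commutators: it vanishes on commuting variables, and modulo it
    words are determined by their letters. *)
Lemma polynomial_quotient (U : {vspace 'M[C]_d}) :
  (forall a b : 'Z_n, a != b -> bracket a b \in U) ->
  (forall M, M \in U -> M^T = - M) ->
  is_quotient_map (ideal_gen (@tens2_TV R n @` [set M | M \in U])) pr.
Proof.
move=> Ubr Uanti; have [pr1 prM] := TV_to_poly_morphism.
have prB s t : pr (s - t) = pr s - pr t.
  by rewrite -scaleN1r TV_to_polyD TV_to_polyZ scaleN1r.
have pr_sum (J : Type) (s : seq J) (F : J -> TVn) : pr (\sum_(x <- s) F x) = \sum_(x <- s) pr (F x).
  exact: (big_morph pr TV_to_polyD TV_to_poly0).
split.
- by move=> c s t; rewrite TV_to_polyD TV_to_polyZ.
- exact: TV_to_poly_morphism.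
- exact: TV_to_poly_surj.
move=> t; split; last first.
  move=> It; apply: (It [set t | pr t = 0]); split.
    exact: (kernel_ideal TV_to_poly_morphism prB).
  move=> _ [M MU <-] /=.
  have -> : pr (tens2_TV M) = \sum_(a : 'Z_n) \sum_(b : 'Z_n) M a b *:
      (mpolyX C (mnm1 a) * mpolyX C (mnm1 b)).
    rewrite /tens2_TV pr_sum; apply: eq_bigr => a _; rewrite pr_sum.
    by apply: eq_bigr => b _; rewrite TV_to_polyZ prM !TV_to_poly_xgen.
  apply: (@antisymmetric_form0 C poly_ring d M (fun a => mpolyX C (mnm1 a))).
    exact: Uanti.
  by move=> a b; apply: mulrC.
apply: TV_to_poly_kernel; first exact: ideal_gen_ideal.
move=> a b; have [<-|ab] := eqVneq a b.
  by rewrite subrr; have [] := ideal_gen_ideal (@tens2_TV R n @` [set M | M \in U]).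
apply: sub_ideal_gen; exists (bracket a b); [exact: Ubr|exact: tens2_TV_bracket].
Qed.

End Presentation.

(** * The relations at the origin *)

Section RelationsAtOrigin.
Context {R : realType}.
Local Notation C := R[i].
Variables (eta : C) (n k : nat).
Hypothesis eta_im : 0 < complex.Im eta.
Hypothesis n_gt1 : (1 < n)%N.
Hypothesis coprime_nk : coprime n k.
Local Notation d := (Zp_trunc n).+2.

Lemma bracket_in_rel (a b : 'Z_n) : a != b -> bracket a b \in rel_nk n k eta 0.
Proof.
move=> ab; have nz := rvec_neq_not_identically_zero eta_im n_gt1 ab.
rewrite memvE -(Lline_off_diagonal eta_im n_gt1 coprime_nk ab).
apply: (sumv_sup a) => //; apply: (sumv_sup b) => //.
exact/asboolP.
Qed.

Lemma bracket_anti (a b : 'Z_n) : (bracket a b)^T = - bracket a b :> 'M[C]_d.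
Proof. by rewrite /bracket !tens_xgen linearB /= !trmx_delta opprB. Qed.

(** All the lines L_ij(0) are spanned by combinations of commutators. *)
Lemma rel_anti (M : 'M[C]_d) : M \in rel_nk n k eta 0 -> M^T = - M.
Proof.
have anti_line (v w : 'M[C]_d) : v^T = - v -> w \in <[v]>%VS -> w^T = - w.
  by move=> va /vlineP[c ->]; rewrite linearZ /= va scalerN.
have anti_sum (I : finType) (P : pred I) (F : I -> 'M[C]_d) :
    (forall i, P i -> (F i)^T = - F i) -> (\sum_(i | P i) F i)^T = - \sum_(i | P i) F i.
  by move=> FA; rewrite raddf_sum -sumrN; apply: eq_bigr.
move=> /memv_sumP[F FL ->]; apply: (anti_sum) => i _.
have /memv_sumP[G GL ->] := FL i isT; apply: (anti_sum) => j /asboolP nz.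
have := GL j (introT (asboolP _) nz).
have [ij|ij] := eqVneq i j; last first.
  rewrite (Lline_off_diagonal eta_im n_gt1 coprime_nk ij).
  exact/anti_line/bracket_anti.
rewrite -ij in nz *; rewrite (Lline_diagonal eta_im n_gt1 coprime_nk nz).
apply: anti_line; rewrite raddf_sum -sumrN; apply: eq_bigr => r _.
by rewrite [LHS]linearZ -scalerN; congr (_ *: _); apply: bracket_anti.
Qed.

End RelationsAtOrigin.

Unset Implicit Arguments.
Local Close Scope classical_set_scope.

Theorem proposition5p1 (R : realType) (eta : R[i]) (n k : nat)
    (i j : 'Z_n) (eta_im_gt0 : 0 < complex.Im eta)
    (k_ge1 : (1 <= k)%N) (k_lt_n : (k < n)%N) (coprime_nk : coprime n k) :
  [/\ i != j -> Lline k eta i j 0 = <[bracket i j]>%VS,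
      ~ rvec_identically_zero k eta i i ->
      Lline k eta i i 0 =
        <[\sum_(1 <= r < uphalf n)
            (theta_ eta n ((k%:Z - 1) * r%:Z) 0
             / (theta_ eta n (- r%:Z) 0 * theta_ eta n (k%:Z * r%:Z) 0))
            *: bracket (i - r%:R) (i + r%:R)]>%VS
    & is_quotient_map (Q_ideal k eta 0) (@TV_to_poly R n)].
Proof.
have n_gt1 : (1 < n)%N by apply: leq_ltn_trans k_lt_n.
split=> [|nz|].
- exact: Lline_off_diagonal.
- rewrite (Lline_diagonal eta_im_gt0 n_gt1 coprime_nk nz).
  by under eq_bigr do rewrite (diag_coefE _ eta_im_gt0 n_gt1).
apply: polynomial_quotient => [a b|M].
  exact: bracket_in_rel.
exact: rel_anti.
Qed.
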